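(* Let $n\ge 2$ and $1\le k\le n-1$ be integers, let $K$ be a generalized $k$-intersection body in $\mathbb{R}^n$, let $f$ be an even continuous non-negative function on $K$, and let $\varepsilon>0$. If $$\int_{K\cap H} f\ \le\ \varepsilon\qquad\text{for every } H\in Gr_{n-k},$$ then $$\int_K f\ \le\ \frac{n}{n-k}\, c_{n,k}\, |K|^{k/n}\,\varepsilon .$$
   Context: $Gr_{n-k}$ is the Grassmannian of $(n-k)$-dimensional linear subspaces of $\mathbb{R}^n$; $\int_{K\cap H} f$ denotes the integral of the restriction of $f$ to $K\cap H$ with respect to $(n-k)$-dimensional Lebesgue measure on $H$. $|K|$ denotes $n$-dimensional volume. $B_2^m$ is the Euclidean unit ball in $\mathbb{R}^m$ and $c_{n,k}=|B_2^n|^{\frac{n-k}{n}}/|B_2^{n-k}|$ (one has $c_{n,k}\in(e^{-k/2},1)$). A star body is a compact set $K\subset\mathbb{R}^n$ containing the origin in its interior such that every line through the origin meets the boundary of $K$ in exactly two points different from the origin and whose Minkowski functional $\|x\|_K=\min\{a\ge0: x\in aK\}$ is continuous. For $g\in C(S^{n-1})$ and $H\in Gr_{n-k}$, $R_{n-k}g(H)=\int_{S^{n-1}\cap H} g(x)\,dx$ (integration with respect to the surface measure on the $(n-k-1)$-sphere $S^{n-1}\cap H$). An origin-symmetric star body $K$ in $\mathbb{R}^n$ is a generalized $k$-intersection body if there exists a finite non-negative Borel measure $\nu$ on $Gr_{n-k}$ such that $\int_{S^{n-1}}\|x\|_K^{-k}g(x)\,dx=\int_{Gr_{n-k}}R_{n-k}g(H)\,d\nu(H)$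 for every $g\in C(S^{n-1})$. *)

(* Defs.v *)
From mathcomp Require Import all_boot all_order all_algebra.
From mathcomp Require Import all_classical all_reals all_analysis.
Import numFieldNormedType.Exports.
Import Order.TTheory GRing.Theory Num.Theory.


Local Open Scope classical_set_scope.
Local Open Scope ring_scope.

Section Defs.
Variable R : realType.

Definition enorm (n : nat) (x : 'rV[R]_n) : R :=
  Num.sqrt (\sum_(i < n) x ord0 i ^+ 2).

(* Iterated one-dimensional Lebesgue integration over the first m
   coordinates of a point (nat -> R).  For non-negative (resp. integrable)
   Borel functions this is the n-dimensional Lebesgue integral (Tonelli /
   Fubini). *)
Fixpoint iint (m : nat) : ((nat -> R) -> \bar R) -> \bar R :=
  match m with
  | 0 => fun F => F (fun _ => 0)
  | m'.+1 => fun F =>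
      (\int[@lebesgue_measure R]_t
         iint m' (fun x => F (fun i => if i == m' then t else x i)))%E
  end.

Definition leb_int (m : nat) (F : 'rV[R]_m -> \bar R) : \bar R :=
  iint m (fun x => F (\row_(i < m) x i)).

Definition vol (m : nat) (A : set 'rV[R]_m) : R :=
  fine (leb_int m (fun x => (\1_A x)%:E)).

Definition ball2 (m : nat) : set 'rV[R]_m := [set x | enorm m x <= 1].

(* Surface integral over S^{m-1}, with surface measure sigma defined by
   polar coordinates: sigma(A) = m |{t x : x in A, 0 < t <= 1}|. *)
Definition sphere_int (m : nat) (g : 'rV[R]_m -> R) : \bar R :=
  (m%:R%:E * leb_int m (fun x =>
     (if (0 < enorm m x <= 1) then g ((enorm m x)^-1 *: x) else 0)%:E))%E.

(* The Grassmannian Gr_m of m-dimensional linear subspaces of R^n, each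
   subspace H being represented by the orthogonal projection matrix onto H. *)
Definition Gr (n m : nat) : set 'M[R]_n :=
  [set P | P^T = P /\ P *m P = P /\ \rank P = m].

Definition subsp (n : nat) (P : 'M[R]_n) : set 'rV[R]_n :=
  [set x | x *m P = x].

Definition onb (n m : nat) (P : 'M[R]_n) : 'M[R]_(m, n) :=
  xget 0 [set U : 'M[R]_(m, n) | U *m U^T = 1%:M /\ U^T *m U = P].

Definition sub_int (n m : nat) (P : 'M[R]_n) (F : 'rV[R]_n -> \bar R)
  : \bar R := leb_int m (fun y : 'rV[R]_m => F (y *m onb n m P)).

(* Integral over the (m-1)-sphere S^{n-1} cap H w.r.t. its surface measure
   (again by polar coordinates inside H): this is R_m g (H). *)
Definition radon (n m : nat) (P : 'M[R]_n) (g : 'rV[R]_n -> R) : \bar R :=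
  (m%:R%:E * sub_int n m P (fun x =>
     (if (0 < enorm n x <= 1) then g ((enorm n x)^-1 *: x) else 0)%:E))%E.

Definition mink (n : nat) (K : set 'rV[R]_n) (x : 'rV[R]_n) : R :=
  inf [set a : R | 0 <= a /\ exists2 y, K y & x = a *: y].

Definition sphere (n : nat) : set 'rV[R]_n := [set x | enorm n x = 1].

Definition star_body (n : nat) (K : set 'rV[R]_n) : Prop :=
  [/\ compact K, interior K 0,
      (forall u : 'rV[R]_n, u != 0 ->
         exists p q : 'rV[R]_n,
           [/\ p != q, p != 0, q != 0 &
               (closure K `\` interior K) `&` [set t *: u | t in [set: R]]
               = [set p; q]]) &
      continuous (mink n K)].

Definition origin_symmetric (n : nat) (K : set 'rV[R]_n) : Prop :=
  forall x, K x -> K (- x).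

Definition BorelM (n : nat) := g_sigma_algebraType (@open 'M[R]_n).

(* Generalized k-intersection body: a finite non-negative Borel measure nu
   on Gr_{n-k} (a finite Borel measure on matrices concentrated on Gr_{n-k}). *)
Definition gen_intersection_body (n k : nat) (K : set 'rV[R]_n) : Prop :=
  star_body n K /\ origin_symmetric n K /\
  exists nu : {measure set (BorelM n) -> \bar R},
    [/\ (nu setT < +oo)%E, nu (~` Gr n (n - k)%N) = 0%E &
        forall g : 'rV[R]_n -> R, {within sphere n, continuous g} ->
          sphere_int n (fun x => ((mink n K x) ^+ k)^-1 * g x) =
          (\int[nu]_(P in Gr n (n - k)%N) radon n (n - k)%N P g)%E].

Definition cnk (n k : nat) : R :=
  powR (vol n (ball2 n)) ((n - k)%:R / n%:R) / vol (n - k)%N (ball2 (n - k)%N).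

End Defs.

Arguments enorm {R n}.
Arguments iint {R}.
Arguments leb_int {R m}.
Arguments vol {R m}.
Arguments ball2 {R m}.
Arguments sphere_int {R m}.
Arguments Gr {R}.
Arguments subsp {R n}.
Arguments onb {R n}.
Arguments sub_int {R n}.
Arguments radon {R n}.
Arguments mink {R n}.
Arguments sphere {R}.
Arguments star_body {R n}.
Arguments origin_symmetric {R n}.
Arguments BorelM {R}.
Arguments gen_intersection_body {R n}.
Arguments cnk {R}.

(* Main.v *)
Require Import Defs.
From mathcomp Require Import all_boot all_order all_algebra.
From mathcomp Require Import all_classical all_reals all_analysis.
From mathcomp Require Import measurable_realfun ring lra.
Import numFieldNormedType.Exports.
Import Order.TTheory GRing.Theory Num.Theory.
Local Open Scope classical_set_scope.
Local Open Scope ring_scope.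
Set Implicit Arguments.
Unset Strict Implicit.
Unset Printing Implicit Defensive.

(* Write rho = 1 / mink K for the radial function of K, m = n - k, and
   g(th) = int_0^{rho(th)} r^(m-1) f(r th) dr, a continuous function on the
   sphere.  In polar coordinates the integral of f over K cap H is the Radon
   transform R_m g(H), so R_m g <= eps.  Since r^(n-1) <= rho^k r^(m-1) for
   r <= rho, the integral of f over K is at most the integral of rho^k g over
   the sphere, that is, the integral of R_m g against nu, which is at most
   eps nu(Gr_m).  Testing the defining identity of nu with g = 1 gives
   m |B_2^m| nu(Gr_m) = int rho^k, and Hoelder's inequality together with
   |K| = (1/n) int rho^n bounds the right-hand side by
   n |B_2^n|^(m/n) |K|^(k/n). *)

(** * Iterated integrals of non-negative functions *)

(** [leb_int] is an iterated one-dimensional integral, and the sphere integrals are integrals of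
    degree-zero extensions over the punctured unit ball. Polar coordinates are therefore an identity
    between two values of [leb_int]; it is derived from Tonelli, homotheties and one power integral,
    and carries over to H through an orthonormal basis. Two obstacles shape the rest. The identity
    defining nu accepts only test functions continuous on the sphere, whereas [f] is continuous only
    on K and its extension by 0 may jump at the boundary; continuity of g is obtained by rescaling
    each radius to the fixed interval [0, 1], along points that never leave K. Moreover, a star body
    is given through boundary points on lines and through [mink], so it has to be proved that the
    whole segment of length rho in each direction lies in K. The factor n/(n-k) compares two
    normalizations of surface measure: n is the polar factor of R^n, and n-k enters through the area
    of the unit sphere of H. *)

Section IteratedIntegral.
Variable R : realType.
Local Notation mu := (@lebesgue_measure R).

(* All dimensions share the domain of iint, sequences of reals, here with the
   product sigma-algebra; this makes induction on the dimension possible. *)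
Definition cylinders : set (set (nat -> R)) :=
  [set A | exists i, exists2 B : set R, measurable B & A = (fun x => x i) @^-1` B].

Definition coordType : measurableType (cylinders.-sigma) :=
  g_sigma_algebraType cylinders.

(** Convertible to the substitution inside [iint], so that [iintS] holds by computation. *)
Definition upd (m : nat) (t : R) (x : nat -> R) : nat -> R :=
  fun i => if i == m then t else x i.

Lemma measurable_fun_coordP d (T : measurableType d) (h : T -> coordType) :
  (forall i, measurable_fun setT (fun t => (h t : nat -> R) i)) ->
  measurable_fun setT h.
Proof.
move=> mh; apply: (measurability (cylinders : set (set coordType))) => // A [_ [i [B mB ->]] <-].
exact: mh.
Qed.

Lemma measurable_coord i : measurable_fun setT (fun x : coordType => (x : nat -> R) i).
Proof.
move=> _ B mB; rewrite setTI; apply: sub_sigma_algebra.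
by exists i, B.
Qed.

Lemma measurable_upd m d (T : measurableType d) (t : T -> R) (x : T -> coordType) :
  measurable_fun setT t -> measurable_fun setT x ->
  measurable_fun setT (fun z => upd m (t z) (x z) : coordType).
Proof.
move=> mt mx; apply: measurable_fun_coordP => i; rewrite /upd.
case: eqP => // _.
exact: (measurableT_comp (measurable_coord i) mx).
Qed.

Lemma iintS m (F : (nat -> R) -> \bar R) :
  iint m.+1 F = (\int[mu]_t iint m (fun x => F (upd m t x)))%E.
Proof. by []. Qed.

Local Open Scope ereal_scope.

Lemma iint_ge0 m (F : (nat -> R) -> \bar R) : (forall x, 0 <= F x) -> 0 <= iint m F.
Proof.
elim: m F => [|m IH] F F0; first exact: F0.
by rewrite iintS; apply: integral_ge0 => t _; apply: IH.
Qed.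

(** The parameter type is generalized in the induction: the outermost coordinate joins the
    parameter, the induction hypothesis handles the remaining ones over the product, and the
    measurability part of Tonelli integrates that coordinate out. *)
Lemma measurable_iint m d (T : measurableType d) (F : T * coordType -> \bar R) :
  measurable_fun setT F -> (forall z, 0 <= F z) ->
  measurable_fun setT (fun t => iint m (fun x => F (t, x))).
Proof.
elim: m d T F => [|m IH] d T F mF F0.
  exact: (measurable_fun_pair1 ((fun _ => 0%R) : coordType) mF).
have mH : measurable_fun setT
    (fun p : (T * measurableTypeR R) * coordType => F (p.1.1, upd m p.1.2 p.2 : coordType)).
  apply: (measurableT_comp mF); apply/measurable_fun_pair.
    exact: (measurableT_comp measurable_fst measurable_fst).
  apply: measurable_upd => //.
  exact: (measurableT_comp measurable_snd measurable_fst).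
have h := IH _ _ _ mH (fun z => F0 _).
apply: (measurable_fun_fubini_tonelli_F (m2:=mu) _ h) => z.
by apply: iint_ge0 => x; exact: F0.
Qed.

(** One coordinate at a time: two-variable Tonelli exchanges [nu] with the outermost coordinate, and
    the induction hypothesis applies to the others with that coordinate frozen. *)
Lemma iint_Tonelli m d (T : measurableType d) (nu : {sigma_finite_measure set T -> \bar R})
   (F : T * coordType -> \bar R) :
  measurable_fun setT F -> (forall z, 0 <= F z) ->
  \int[nu]_t iint m (fun x => F (t, x)) = iint m (fun x => \int[nu]_t F (t, x)).
Proof.
elim: m F => [|m IH] F mF F0 //.
rewrite iintS.
have mH : measurable_fun setT
    (fun p : (T * measurableTypeR R) * coordType => F (p.1.1, upd m p.1.2 p.2 : coordType)).
  apply: (measurableT_comp mF); apply/measurable_fun_pair.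
    exact: (measurableT_comp measurable_fst measurable_fst).
  apply: measurable_upd => //.
  exact: (measurableT_comp measurable_snd measurable_fst).
rewrite (fubini_tonelli (m1 := nu) (m2 := mu)
  (fun p => iint m (fun x => F (p.1, upd m p.2 x)))); first last.
- by move=> z; apply: iint_ge0.
- exact: (measurable_iint m mH).
apply: eq_integral => t _ /=.
rewrite (IH (fun p => F (p.1, upd m t p.2 : coordType)))//.
apply: (measurableT_comp mF); apply/measurable_fun_pair => //.
exact: measurable_upd.
Qed.

Lemma measurable_iint_upd m p (F : coordType -> \bar R) :
  measurable_fun setT F -> (forall z, 0 <= F z) ->
  measurable_fun setT (fun t : measurableTypeR R => iint m (fun x => F (upd p t x))).
Proof.
move=> mF F0.
apply: (measurable_iint m
  (F := fun z : measurableTypeR R * coordType => F (upd p z.1 z.2))) => //.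
by apply: (measurableT_comp mF); exact: (measurable_upd p measurable_fst measurable_snd).
Qed.

Lemma measurable_updF p t (F : coordType -> \bar R) :
  measurable_fun setT F -> measurable_fun setT (fun x : coordType => F (upd p t x)).
Proof.
move=> mF; apply: (measurableT_comp mF).
by apply: (measurable_upd p (t := cst t) (x := id)).
Qed.

Lemma eq_iint m (F G : (nat -> R) -> \bar R) : F =1 G -> iint m F = iint m G.
Proof. by move=> /funext ->. Qed.

Lemma le_iint m (F G : coordType -> \bar R) :
  measurable_fun setT F -> measurable_fun setT G ->
  (forall x, 0 <= F x) -> (forall x, F x <= G x) -> iint m F <= iint m G.
Proof.
elim: m F G => [|m IH] F G mF mG F0 FG; first exact: FG.
have G0 x : 0 <= G x by exact: le_trans (FG x).
rewrite !iintS; apply: ge0_le_integral => //.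
- by move=> t _; exact: iint_ge0.
- exact: measurable_iint_upd.
- exact: measurable_iint_upd.
- by move=> t _; apply: IH => //; exact: measurable_updF.
Qed.

Lemma iintD m (F G : coordType -> \bar R) :
  measurable_fun setT F -> measurable_fun setT G ->
  (forall x, 0 <= F x) -> (forall x, 0 <= G x) ->
  iint m (fun x => F x + G x) = iint m F + iint m G.
Proof.
elim: m F G => [|m IH] F G mF mG F0 G0; first by [].
rewrite !iintS -ge0_integralD//.
- by apply: eq_integral => t _; apply: IH => //; exact: measurable_updF.
- by move=> t _; exact: iint_ge0.
- exact: measurable_iint_upd.
- by move=> t _; exact: iint_ge0.
- exact: measurable_iint_upd.
Qed.

Lemma iintZl m (c : R) (F : coordType -> \bar R) :
  measurable_fun setT F -> (forall x, 0 <= F x) -> (0 <= c)%R ->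
  iint m (fun x => c%:E * F x) = c%:E * iint m F.
Proof.
elim: m F => [|m IH] F mF F0 c0; first by [].
rewrite !iintS -ge0_integralZl_EFin//.
- by apply: eq_integral => t _; apply: IH => //; exact: measurable_updF.
- by move=> t _; exact: iint_ge0.
- exact: measurable_iint_upd.
Qed.

(** Lebesgue measure equals c times its image under multiplication by c: the preimage of an interval
    from a to b runs from a/c to b/c, and agreement on such intervals determines the measure. *)
Lemma ge0_integral_scale (c : R) (f : R -> \bar R) : (0 < c)%R ->
  measurable_fun [set: R] f -> (forall r, 0 <= f r) ->
  \int[mu]_r f r = c%:E * \int[mu]_r f (c * r)%R.
Proof.
move=> c0 mf f0.
have mc : measurable_fun setT ( *%R c : measurableTypeR R -> measurableTypeR R).
  exact: measurable_funM.
transitivity (c%:E *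
    \int[pushforward mu ( *%R c : measurableTypeR R -> measurableTypeR R)]_r f r);
  last first.
  by rewrite (ge0_integral_pushforward mc)// preimage_setT.
pose cn : {nonneg R} := NngNum (ltW c0).
rewrite -[X in X * _]/(cn%:num%:E) -(ge0_integral_mscale _ _ cn)//.
apply: eq_measure_integral => A mA _.
apply: lebesgue_measure_unique => // _ [[a b] /= _ <-].
rewrite /mscale /= /pushforward /=.
rewrite (_ : _ @^-1` _ = `](a / c)%R, (b / c)%R]%classic); last first.
  by apply/seteqP; split => x /=; rewrite !in_itv/= ltr_pdivrMr// ler_pdivlMr// mulrC.
rewrite !lebesgue_measure_itv/= !lte_fin ltr_pM2r ?invr_gt0//.
case: ifP => _; last by rewrite mule0.
by rewrite -!EFinD -EFinM -mulrBl mulrC divfK ?gt_eqF.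
Qed.

Lemma iint_scale m (c : R) (F : coordType -> \bar R) : (0 < c)%R ->
  measurable_fun setT F -> (forall x, 0 <= F x) ->
  iint m F = (c ^+ m)%:E * iint m (fun x => F (fun i => c * x i)%R).
Proof.
elim: m F => [|m IH] F c0 mF F0.
  (* In dimension 0 the integral is the value at the zero sequence, which scaling fixes. *)
  by rewrite expr0 mul1e /=; congr F; apply/funext => i; rewrite mulr0.
have mFc : measurable_fun setT (fun x : coordType => F (fun i => c * (x : nat -> R) i)%R).
  apply: (measurableT_comp mF); apply: measurable_fun_coordP => i.
  by apply: measurable_funM => //; exact: measurable_coord.
rewrite !iintS (ge0_integral_scale c0)//; last 2 first.
- exact: measurable_iint_upd.
- by move=> r; exact: iint_ge0.
rewrite exprS EFinM -muleA; congr (_ * _).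
rewrite -ge0_integralZl_EFin//; last 3 first.
- by move=> t _; exact: iint_ge0.
- exact: (measurable_iint_upd m m mFc).
- by rewrite exprn_ge0// ltW.
apply: eq_integral => t _; rewrite IH//; last exact: measurable_updF.
congr (_ * _); apply: eq_iint => x; congr F; apply/funext => i.
by rewrite /upd; case: eqP.
Qed.

(** It suffices to discard the value 0 of the outermost variable, a null set; for any other value
    the point has a non-zero coordinate. This needs at least one coordinate, hence [m.+1]. *)
Lemma iint_off0 m (F G : coordType -> \bar R) :
  measurable_fun setT F -> measurable_fun setT G ->
  (forall x, 0 <= F x) -> (forall x, 0 <= G x) ->
  (forall x : nat -> R, (exists2 i, (i <= m)%N & x i != 0%R) -> F x = G x) ->
  iint m.+1 F = iint m.+1 G.
Proof.
move=> mF mG F0 G0 FG; rewrite !iintS.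
apply: ge0_ae_eq_integral => //.
- exact: measurable_iint_upd.
- exact: measurable_iint_upd.
- by move=> t _; exact: iint_ge0.
- by move=> t _; exact: iint_ge0.
exists [set 0%R]; split => //; first exact: lebesgue_measure_set1.
move=> t /= /not_implyP[_]; apply: contra_notP => /eqP t0.
apply: eq_iint => x; apply: FG; exists m => //.
by rewrite /upd eqxx.
Qed.

End IteratedIntegral.

(** * Borel functions of row vectors *)

Section BorelRows.
Variable R : realType.
Local Notation mu := (@lebesgue_measure R).

Definition borelV (m : nat) : measurableType ((@open 'rV[R]_m).-sigma) :=
  g_sigma_algebraType (@open 'rV[R]_m).

Lemma open_measurableV m (A : set (borelV m)) : open (A : set 'rV[R]_m) -> measurable A.
Proof. by move=> oA; apply: sub_sigma_algebra. Qed.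

Lemma closed_measurableV m (A : set (borelV m)) :
  closed (A : set 'rV[R]_m) -> measurable A.
Proof.
move=> cA; rewrite -[A]setCK; apply: measurableC; apply: open_measurableV.
exact: closed_openC.
Qed.

(** Balls of row vectors are boxes for the sup norm, so countably many rational boxes reduce Borel
    measurability to coordinates. *)
Lemma open_rat_balls m (U : set 'rV[R]_m) : open U ->
  U = \bigcup_(q : 'rV[rat]_m * rat)
        (if `[< ball (map_mx ratr q.1 : 'rV[R]_m) (ratr q.2) `<=` U >]
         then ball (map_mx ratr q.1 : 'rV[R]_m) (ratr q.2) else set0).
Proof.
move=> oU; apply/seteqP; split => x; last first.
  by move=> [q _]; case: asboolP => // qU; exact: qU.
move=> Ux.
have /nbhs_ballP[e /= e0 xeU] : nbhs x U by exact: open_nbhs_nbhs.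
have [r] : exists r : rat, (ratr r : R) \in `]0, (e / 2)[.
  by apply: rat_in_itvoo; rewrite divr_gt0.
rewrite in_itv/= => /andP[r0 re].
have qex (i : 'I_m) : exists q : rat,
    (ratr q : R) \in `](x ord0 i - ratr r), (x ord0 i + ratr r)[.
  by apply: rat_in_itvoo; rewrite ltrD2l gtrN.
have [q qP] := choice qex.
exists (\row_i q i, r) => //=.
have xq : ball (map_mx ratr (\row_i q i) : 'rV[R]_m) (ratr r) x.
  split => // i j; rewrite ord1 !mxE /ball/=.
  have := qP j; rewrite in_itv/= => /andP[q1 q2].
  by rewrite ltr_norml; apply/andP; split; lra.
rewrite asboolT// => y qy; apply: xeU.
apply: le_ball (ball_triangle (ball_sym xq) qy).
by rewrite (splitr e) lerD// ltW.
Qed.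

Lemma measurable_fun_rowP m d (T : measurableType d) (h : T -> borelV m) :
  (forall i, measurable_fun setT (fun t => (h t : 'rV[R]_m) ord0 i)) ->
  measurable_fun setT h.
Proof.
move=> mh; apply: (measurability (@open 'rV[R]_m : set (set (borelV m)))) => //.
move=> _ [U oU <-]; rewrite setTI (open_rat_balls oU) preimage_bigcup.
apply: countable_bigcupT_measurable => //= -[q r]/=.
case: asboolP => _; last by rewrite preimage_set0.
(* A ball of non-positive radius is empty, whereas for [m = 0] the intersection over coordinates is
   the whole space; the two cases must be separated. *)
have [r0|r0] := ltP 0 (ratr r : R); last first.
  rewrite (_ : _ @^-1` _ = set0)//; apply/seteqP; split => t //= -[].
  by rewrite ltNge r0.
rewrite (_ : _ @^-1` _ = \bigcap_(i in [set: 'I_m])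
    ((fun t => (h t : 'rV[R]_m) ord0 i) @^-1` ball (ratr (q ord0 i) : R) (ratr r))).
  apply: fin_bigcap_measurable => // i _.
  by rewrite -[X in measurable X]setTI; apply: mh => //; exact: measurable_ball.
apply/seteqP; split => t /=.
  by move=> [_ +] i _ => /(_ ord0 i); rewrite !mxE.
by move=> ht; split => // i j; rewrite ord1 !mxE; exact: ht.
Qed.

Lemma measurable_row m : measurable_fun setT
  (fun x : coordType R => \row_(i < m) (x : nat -> R) i : borelV m).
Proof.
apply: measurable_fun_rowP => i; under eq_fun do rewrite mxE.
exact: measurable_coord.
Qed.

Lemma measurable_fun_superlevel m (f : borelV m -> R) :
  (forall a, measurable (f @^-1` `[a, +oo[)) -> measurable_fun setT f.
Proof.
move=> hf; apply: (measurability (@RGenCInfty.G R)).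
  exact: RGenCInfty.measurableE.
by move=> _ [_ [a ->] <-]; rewrite setTI.
Qed.

Lemma continuous_measurableV m (f : 'rV[R]_m -> R) :
  continuous f -> measurable_fun setT (f : borelV m -> R).
Proof.
move=> cf; apply: measurable_fun_superlevel => a.
by apply: closed_measurableV; apply: preimage_closed => //; exact: interval_closed.
Qed.

(** Extension by 0 keeps superlevel sets closed because f is non-negative on K: for a <= 0 such a
    set is everything, and for a > 0 it lies in K and is relatively closed there. *)
Lemma within_continuous_measurableV m (K : set 'rV[R]_m) (f : 'rV[R]_m -> R) :
  closed K -> {within K, continuous f} -> (forall x, K x -> 0 <= f x) ->
  measurable_fun setT ((fun x => \1_K x * f x) : borelV m -> R).
Proof.
move=> cK cf f0; apply: measurable_fun_superlevel => a.
have [a0|a0] := leP a 0.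
  rewrite (_ : _ @^-1` _ = setT)//; apply/seteqP; split => x //= _.
  rewrite in_itv/= andbT (le_trans a0)// indicE.
  by case: (boolP (x \in K)); rewrite ?mul0r// inE mul1r; exact: f0.
rewrite (_ : _ @^-1` _ = K `&` f @^-1` `[a, +oo[); last first.
  apply/seteqP; split => x /=; rewrite !in_itv/= !andbT indicE.
    case: (boolP (x \in K)); first by rewrite inE mul1r.
    by rewrite mul0r leNgt a0.
  by move=> [Kx]; rewrite mem_set// mul1r.
apply: closed_measurableV => x clx.
have Kx : K x by apply: cK; exact: closure_subset clx.
split => //=; rewrite in_itv/= andbT leNgt; apply/negP => fxa.
have /subspace_continuousP/(_ x Kx) fx := cf.
have : within K (nbhs x) (f @^-1` [set y | y < a]).
  by apply: fx; exact: open_nbhs_nbhs (conj (@open_lt _ _) fxa).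
rewrite /within/= => /clx[y [[Ky]]]; rewrite /= in_itv/= andbT => ay /(_ Ky).
by rewrite ltNge ay.
Qed.

Local Open Scope ereal_scope.

Section LebInt.
Variable m : nat.
Implicit Types F G : borelV m -> \bar R.

Lemma leb_int_ge0 F : (forall x, 0 <= F x) -> 0 <= leb_int F.
Proof. by move=> F0; exact: iint_ge0. Qed.

Lemma eq_leb_int F G : F =1 G -> leb_int F = leb_int G.
Proof. by move=> /funext ->. Qed.

Lemma measurable_row_comp F : measurable_fun setT F ->
  measurable_fun setT (fun x : coordType R => F (\row_(i < m) (x : nat -> R) i)).
Proof. by move=> mF; exact: (measurableT_comp mF (@measurable_row m)). Qed.

Lemma measurable_row_comp2 d (T : measurableType d) (F : T * borelV m -> \bar R) :
  measurable_fun setT F -> measurable_fun setT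
    (fun z : T * coordType R => F (z.1, \row_(i < m) (z.2 : nat -> R) i)).
Proof.
move=> mF; apply: (measurableT_comp mF); apply/measurable_fun_pair => //.
exact: (measurableT_comp (@measurable_row m)).
Qed.

Lemma le_leb_int F G : measurable_fun setT F -> measurable_fun setT G ->
  (forall x, 0 <= F x) -> (forall x, F x <= G x) -> leb_int F <= leb_int G.
Proof.
move=> mF mG F0 FG; apply: (le_iint m (measurable_row_comp mF) (measurable_row_comp mG)) => //.
Qed.

Lemma leb_intD F G : measurable_fun setT F -> measurable_fun setT G ->
  (forall x, 0 <= F x) -> (forall x, 0 <= G x) ->
  leb_int (fun x => F x + G x) = leb_int F + leb_int G.
Proof.
move=> mF mG F0 G0.
exact: (iintD m (measurable_row_comp mF) (measurable_row_comp mG)).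
Qed.

Lemma leb_intZl (c : R) F : measurable_fun setT F -> (forall x, 0 <= F x) ->
  (0 <= c)%R -> leb_int (fun x => c%:E * F x) = c%:E * leb_int F.
Proof. by move=> mF F0; exact: (iintZl m (measurable_row_comp mF)). Qed.

Lemma leb_int_scale (c : R) F : (0 < c)%R -> measurable_fun setT F ->
  (forall x, 0 <= F x) ->
  leb_int F = (c ^+ m)%:E * leb_int (fun x : 'rV[R]_m => F (c *: x)%R).
Proof.
move=> c0 mF F0; rewrite /leb_int (iint_scale m c0 (measurable_row_comp mF))//.
congr (_ * _); apply: eq_iint => x; congr F.
by apply/rowP => i; rewrite !mxE.
Qed.

Lemma leb_int_Tonelli d (T : measurableType d)
    (nu : {sigma_finite_measure set T -> \bar R}) (F : T * borelV m -> \bar R) :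
  measurable_fun setT F -> (forall z, 0 <= F z) ->
  \int[nu]_t leb_int (fun x : 'rV[R]_m => F (t, x)) =
  leb_int (fun x : 'rV[R]_m => \int[nu]_t F (t, x)).
Proof.
by move=> mF F0; apply: (iint_Tonelli m nu (measurable_row_comp2 mF)).
Qed.

End LebInt.

Lemma leb_int_off0 m (F G : borelV m -> \bar R) : (0 < m)%N ->
  measurable_fun setT F -> measurable_fun setT G ->
  (forall x, 0 <= F x) -> (forall x, 0 <= G x) ->
  (forall x : 'rV[R]_m, x != 0%R -> F x = G x) ->
  leb_int F = leb_int G.
Proof.
case: m F G => // m F G _ mF mG F0 G0 FG.
apply: (iint_off0 (measurable_row_comp mF) (measurable_row_comp mG)) => //.
move=> x [i im xi]; apply: FG.
apply: contraNneq xi => /rowP/(_ (Ordinal (im : (i < m.+1)%N))).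
by rewrite !mxE/= => ->.
Qed.

End BorelRows.

(** * The Euclidean norm *)

Section Polar.
Variable R : realType.
Local Notation mu := (@lebesgue_measure R).

Lemma enorm_ge0 m (x : 'rV[R]_m) : 0 <= enorm x.
Proof. exact: sqrtr_ge0. Qed.

Lemma enorm_sqr m (x : 'rV[R]_m) : enorm x ^+ 2 = \sum_(i < m) x ord0 i ^+ 2.
Proof. by rewrite sqr_sqrtr// sumr_ge0// => i _; rewrite sqr_ge0. Qed.

Lemma enorm_gt0 m (x : 'rV[R]_m) : (0 < enorm x) = (x != 0).
Proof.
rewrite lt_neqAle enorm_ge0 andbT eq_sym; congr (~~ _).
rewrite -sqrf_eq0 enorm_sqr; apply/eqP/eqP => [s0|->]; last first.
  by rewrite big1// => i _; rewrite mxE expr0n.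
apply/rowP => i; rewrite mxE; apply/eqP; rewrite -sqrf_eq0.
move/eqP: s0; rewrite psumr_eq0; last by move=> j _; rewrite sqr_ge0.
by move=> /allP/(_ i); rewrite mem_index_enum => /(_ isT).
Qed.

Lemma enormZ m (c : R) (x : 'rV[R]_m) : enorm (c *: x) = `|c| * enorm x.
Proof.
rewrite /enorm; under eq_bigr do rewrite mxE exprMn.
by rewrite -mulr_sumr sqrtrM ?sqr_ge0// sqrtr_sqr.
Qed.

Lemma continuous_enorm m : continuous (@enorm R m).
Proof.
move=> x; apply: (continuous_comp (f := fun x : 'rV[R]_m => \sum_(i < m) x ord0 i ^+ 2)
   (g := Num.sqrt)); last exact: sqrt_continuous.
apply: (cvg_big add_continuous (F := nbhs x)) => i _.
by apply: cvgM; exact: coord_continuous.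
Qed.

Lemma measurable_enorm m : measurable_fun setT (@enorm R m : borelV R m -> R).
Proof. by apply: continuous_measurableV; exact: continuous_enorm. Qed.

(** Inversion is odd and agrees with the real power of exponent -1 on non-negative numbers, 0
    included, since both conventions give 0 there. *)
Lemma measurable_invr : measurable_fun setT (@GRing.inv R).
Proof.
rewrite (_ : GRing.inv = fun x => if 0 <= x then x `^ (-1) else - (- x) `^ (-1)).
  apply: measurable_fun_ifT.
  - exact: measurable_fun_ler.
  - exact: measurable_powR.
  - apply: measurableT_comp => //.
    by apply: (measurableT_comp (measurable_powR _)).
apply/funext => x; case: leP => x0; first by rewrite powR_inv1.
by rewrite powR_inv1 ?oppr_ge0 ?ltW// invrN opprK.
Qed.

Lemma measurable_scalerow m d (T : measurableType d) (c : T -> R) (x : T -> borelV R m) :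
  measurable_fun setT c -> measurable_fun setT x ->
  measurable_fun setT (fun t => c t *: (x t : 'rV[R]_m) : borelV R m).
Proof.
move=> mc mx; apply: measurable_fun_rowP => i; under eq_fun do rewrite mxE.
apply: measurable_funM => //.
apply: (measurableT_comp (f := fun v : borelV R m => (v : 'rV[R]_m) ord0 i)) => //.
by apply: continuous_measurableV; exact: coord_continuous.
Qed.

Lemma integral_exprV d (a : R) : (0 < d)%N -> 0 < a ->
  (\int[mu]_(s in `[a, +oo[) (s ^- d.+1)%:E = (d%:R^-1 * a ^- d)%:E)%E.
Proof.
move=> d0 a0; pose F (s : R) : R := - (d%:R^-1 * s ^- d).
have dF (s : R) : 0 < s -> is_derive s 1 F (s ^- d.+1).
  move=> s0.
  have h : is_derive s (1 : R) (fun s : R => (s ^+ d)^-1)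
      (- (s ^+ d) ^- 2 *: (d%:R * s ^+ d.-1 *: 1)).
    apply: is_deriveV; first by rewrite expf_neq0 ?gt_eqF.
    have := is_deriveX d (is_derive_id s (1 : R)).
    by rewrite (_ : id ^+ d = (fun s : R => s ^+ d))//; apply/funext => y; rewrite fctE.
  rewrite /F.
  have -> : s ^- d.+1 = - (d%:R^-1 *: (- (s ^+ d) ^- 2 *: (d%:R * s ^+ d.-1 *: 1))) :> R.
    rewrite /GRing.scale/= mulr1 mulNr mulrN opprK.
    rewrite -[in RHS](prednK d0) -[in LHS](prednK d0) !exprS.
    by field; rewrite expf_neq0 ?gt_eqF//= ?prednK// pnatr_eq0 -lt0n.
  exact: is_deriveN.
rewrite (@ge0_continuous_FTC2y _ _ F a 0).
- by rewrite /F sub0e -EFinN opprK.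
- by move=> x ax; rewrite invr_ge0 exprn_ge0// (le_trans (ltW a0)).
- apply: continuous_in_subspaceT => x; rewrite inE/= in_itv/= andbT => ax.
  have x0 : 0 < x by exact: lt_le_trans ax.
  by apply: cvgV; [rewrite expf_neq0// gt_eqF | exact: exprn_continuous].
- rewrite /F -[X in _ --> X]oppr0 -[X in _ --> - X](mulr0 (d%:R^-1)).
  apply: cvgN; apply: cvgMr.
  apply/cvgrPdist_lt => e e0; near=> s.
  have s1 : 1 <= s by near: s; apply: nbhs_pinfty_ge; rewrite num_real.
  have s0 : 0 < s by exact: lt_le_trans s1.
  rewrite sub0r normrN ger0_norm ?invr_ge0 ?exprn_ge0 1?ltW//.
  apply: (@le_lt_trans _ _ s^-1).
    by rewrite lef_pV2 ?posrE ?exprn_gt0// -{1}[s]expr1 ler_weXn2l.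
  by rewrite invf_plt ?posrE//; near: s; apply: nbhs_pinfty_gt; rewrite num_real.
- by move=> x ax; apply: ex_derive; apply: dF; exact: lt_trans ax.
- apply: cvg_at_right_filter; apply: differentiable_continuous; apply/derivable1_diffP.
  by apply: ex_derive; exact: dF.
- move=> x; rewrite in_itv/= andbT => ax; rewrite derive1E.
  by apply: derive_val; apply: dF; exact: lt_trans ax.
Unshelve. all: by end_near. Qed.
End Polar.

(** * Polar coordinates *)

Section PolarFormula.
Variable R : realType.
Local Notation mu := (@lebesgue_measure R).
Local Open Scope ereal_scope.

(** The exponent is independent of the dimension because two weights occur on the same directions of
    R^n: [n.-1], the polar density of R^n, and [(n - k).-1], the polar density of the subspaces
    H. *)
Definition radial (e : nat) d (F : 'rV[R]_d -> \bar R) (th : 'rV[R]_d) : \bar R :=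
  \int[mu]_r (if (0 < r)%R then (r ^+ e)%:E * F (r *: th)%R else 0).

Section Fixed.
Variables (d : nat) (d_gt0 : (0 < d)%N) (F : borelV R d -> \bar R).
Hypotheses (mF : measurable_fun setT F) (F0 : forall x, 0 <= F x).

(** The polar integrand after r = s |x|: of the factor |x|^d, d-1 powers come from r^(d-1) and one
    from dr = |x| ds. *)
Let A (z : measurableTypeR R * borelV R d) : \bar R :=
  if (0 < z.1)%R && (0 < enorm (z.2 : 'rV[R]_d) <= 1)%R then
  (enorm (z.2 : 'rV[R]_d) ^+ d * z.1 ^+ d.-1)%:E * F (z.1 *: (z.2 : 'rV[R]_d))%R else 0.

(** The integrand [A] at x = y/s, with the Jacobian s^-d included: |x|^d s^(d-1) becomes |y|^d s^-1,
    and the condition |x| <= 1 becomes |y| <= s. *)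
Let B (z : measurableTypeR R * borelV R d) : \bar R :=
  if (0 < enorm (z.2 : 'rV[R]_d) <= z.1)%R then
  (enorm (z.2 : 'rV[R]_d) ^+ d * z.1 ^- d.+1)%:E * F z.2 else 0.

Let mfst : measurable_fun setT (fun z : measurableTypeR R * borelV R d => z.1 : R).
Proof. exact: measurable_fst. Qed.

Let men : measurable_fun setT (fun z : measurableTypeR R * borelV R d => enorm (z.2 : 'rV[R]_d)).
Proof. exact: (measurableT_comp (@measurable_enorm R d)). Qed.

Let mA : measurable_fun setT A.
Proof.
apply: measurable_fun_ifT => //.
  apply: measurable_and; first exact: measurable_fun_ltr.
  by apply: measurable_and; [exact: measurable_fun_ltr|exact: measurable_fun_ler].
apply: emeasurable_funM.
  by apply/measurable_EFinP; apply: measurable_funM; exact: measurable_funX.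
apply: (measurableT_comp mF); exact: measurable_scalerow.
Qed.

Let mB : measurable_fun setT B.
Proof.
apply: measurable_fun_ifT => //.
  by apply: measurable_and; [exact: measurable_fun_ltr|exact: measurable_fun_ler].
apply: emeasurable_funM; last exact: (measurableT_comp mF).
apply/measurable_EFinP; apply: measurable_funM; first exact: measurable_funX.
by apply: (measurableT_comp (@measurable_invr R)); exact: measurable_funX.
Qed.

Let A0 z : 0 <= A z.
Proof.
rewrite /A; case: ifPn => // /andP[z0 _]; apply: mule_ge0 => //.
by rewrite lee_fin mulr_ge0// exprn_ge0 ?enorm_ge0// ltW.
Qed.

Let B0 z : 0 <= B z.
Proof.
rewrite /B; case: ifPn => // /andP[z0 z1]; apply: mule_ge0 => //.
by rewrite lee_fin mulr_ge0// ?invr_ge0 exprn_ge0 ?enorm_ge0// (le_trans _ z1)// ltW.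
Qed.

Lemma measurable_radial_integrand (e : nat) (th : 'rV[R]_d) :
  measurable_fun setT (fun r : measurableTypeR R =>
    if (0 < r)%R then (r ^+ e)%:E * F (r *: th)%R else 0).
Proof.
apply: measurable_fun_ifT => //.
- exact: (@measurable_fun_ltr _ _ R).
- apply: emeasurable_funM; first by apply/measurable_EFinP; exact: measurable_funX.
  apply: (measurableT_comp mF).
  exact: (@measurable_scalerow R d _ _ (fun r : measurableTypeR R => r) (cst th)).
Qed.

Let radialE (x : 'rV[R]_d) :
  (if (0 < enorm x <= 1)%R then radial d.-1 F ((enorm x)^-1 *: x) else 0) = \int[mu]_s A (s, x).
Proof.
case: ifPn => [/andP[x0 x1]|xN]; last first.
  by under eq_integral do rewrite /A/= (negbTE xN) andbF; rewrite integral0.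
rewrite /radial (ge0_integral_scale x0); last 2 first.
- exact: measurable_radial_integrand.
- by move=> r; case: ifPn => // r0; apply: mule_ge0; rewrite // lee_fin exprn_ge0// ltW.
rewrite -ge0_integralZl_EFin ?(ltW x0)//; last 2 first.
- by move=> r _; case: ifPn => // r0; apply: mule_ge0; rewrite // lee_fin exprn_ge0// ltW.
- apply: (measurableT_comp (measurable_radial_integrand _ _)).
  exact: measurable_funM.
apply: eq_integral => s _; rewrite /A/= x0 x1 andbT pmulr_rgt0//.
case: ifPn => s0; last by rewrite mule0.
rewrite muleA -EFinM; congr (_%:E * F _).
  by rewrite exprMn mulrA -exprS prednK.
by rewrite scalerA mulrAC mulfV ?gt_eqF// mul1r.
Qed.

Lemma measurable_radial e : measurable_fun setT (radial e F : borelV R d -> \bar R).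
Proof.
apply: (measurable_fun_fubini_tonelli_G (m1 := mu)
  (fun z : measurableTypeR R * borelV R d => if (0 < z.1)%R
    then (z.1 ^+ e)%:E * F (z.1 *: (z.2 : 'rV[R]_d))%R else 0)).
  apply: measurable_fun_ifT => //; first exact: measurable_fun_ltr.
  apply: emeasurable_funM; first by apply/measurable_EFinP; exact: measurable_funX.
  by apply: (measurableT_comp mF); exact: measurable_scalerow.
move=> z; case: ifPn => // z0; apply: mule_ge0 => //.
by rewrite lee_fin exprn_ge0// ltW.
Qed.

Lemma measurable_radial_normalized e :
  measurable_fun setT (fun x : borelV R d => if (0 < enorm (x : 'rV[R]_d) <= 1)%R
    then radial e F ((enorm (x : 'rV[R]_d))^-1 *: (x : 'rV[R]_d)) else 0).
Proof.
apply: measurable_fun_ifT => //.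
  by apply: measurable_and; [apply: measurable_fun_ltr|apply: measurable_fun_ler] => //;
    exact: measurable_enorm.
apply: (measurableT_comp (measurable_radial e)); apply: measurable_scalerow => //.
by apply: (measurableT_comp (@measurable_invr R)); exact: measurable_enorm.
Qed.

Let swapAB s :
  leb_int (fun x : 'rV[R]_d => A (s, x)) = leb_int (fun x : 'rV[R]_d => B (s, x)).
Proof.
have [s0|s0] := ltP 0%R s; last first.
  apply: eq_leb_int => x; rewrite /A /B/= ltNge s0/=.
  by case: ifPn => // /andP[x0]; rewrite leNgt (le_lt_trans s0).
have mBs : measurable_fun setT (fun x : borelV R d => B (s, x)).
  exact: (measurableT_comp mB).
rewrite [RHS](leb_int_scale s0 mBs)// -leb_intZl ?exprn_ge0 1?ltW//; last first.
  exact: (measurableT_comp mBs (measurable_scalerow (c := cst s) (x := id) _ _)).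
apply: eq_leb_int => x; rewrite /A /B/= s0/= enormZ (gtr0_norm s0).
rewrite pmulr_rgt0// ger_pMr//.
case: ifPn => [_|]; last by rewrite mule0.
rewrite muleA -EFinM; congr (_%:E * _).
move: (enorm _) => e; rewrite -(prednK d_gt0)/= exprMn !exprS.
by field; rewrite expf_neq0 ?gt_eqF.
Qed.

(** The condition |x| <= s restricts s to the half-line from |x|, where the integral of s^-(d+1) is
    |x|^-d / d; this cancels the weight |x|^d. *)
Let intB (x : 'rV[R]_d) : x != 0%R -> \int[mu]_s B (s, x) = (d%:R^-1)%:E * F x.
Proof.
move=> x0; have e0 : (0 < enorm x)%R by rewrite enorm_gt0.
rewrite [LHS](_ : _ = \int[mu]_(s in `[enorm x, +oo[)
    ((enorm x ^+ d)%:E * F x * (s ^- d.+1)%:E)).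
  rewrite ge0_integralZl//; last 3 first.
  - apply: measurable_funTS; apply/measurable_EFinP.
    by apply: (measurableT_comp (@measurable_invr R)); exact: measurable_funX.
  - move=> s; rewrite /= in_itv/= andbT => es.
    by rewrite lee_fin invr_ge0 exprn_ge0// (le_trans _ es)// ltW.
  - by apply: mule_ge0; rewrite // lee_fin exprn_ge0// ltW.
  rewrite integral_exprV// muleAC -EFinM; congr (_%:E * _).
  by rewrite mulrCA mulfV ?mulr1// expf_neq0// gt_eqF.
rewrite [RHS]integral_mkcond; apply: eq_integral => s _.
rewrite /B/= e0/= patchE mem_setE in_itv/= andbT; case: ifPn => // _.
by rewrite EFinM muleAC.
Qed.

(* Substitute r = s |x| in the inner integral, exchange, substitute y = s x,
   exchange back, and use int_{|y|}^oo s^-(d+1) ds = |y|^-d / d. *)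
Lemma leb_int_polar : leb_int F = d%:R%:E *
  leb_int (fun x : 'rV[R]_d =>
    if (0 < enorm x <= 1)%R then radial d.-1 F ((enorm x)^-1 *: x) else 0).
Proof.
under [X in _ * X]eq_leb_int do rewrite radialE.
rewrite -(leb_int_Tonelli mu mA)//.
under eq_integral do rewrite swapAB.
rewrite (leb_int_Tonelli mu mB)//.
(* At the origin [B] vanishes while [F] may not; the two sides agree only off this null point. *)
rewrite (leb_int_off0 (F := fun x => \int[mu]_t B (t, x)) (G := fun x => (d%:R^-1)%:E * F x))//.
- rewrite leb_intZl// muleA -EFinM mulfV ?mul1e// pnatr_eq0.
  by rewrite -lt0n.
- exact: (measurable_fun_fubini_tonelli_G (m1 := mu) B mB B0).
- exact: measurable_funeM.
- by move=> x; apply: integral_ge0.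
- by move=> x; apply: mule_ge0; rewrite // lee_fin.
Qed.
End Fixed.

End PolarFormula.

(** * Orthonormal bases and the Grassmannian *)

Section Grassmannian.
Variable R : realType.

(** The lower bound holds because the identity of size m factors as U (U^T U) U^T. *)
Lemma orthonormal_rank n m (U : 'M[R]_(m, n)) : U *m U^T = 1%:M -> \rank (U^T *m U) = m.
Proof.
move=> UU; apply/eqP; rewrite eqn_leq; apply/andP; split.
  by rewrite (leq_trans (mxrankM_maxr _ _))// rank_leq_row.
rewrite -{1}(mxrank1 R m) -[X in \rank X]mulmx1 -{1}UU -{1}UU.
rewrite mulmxA -[X in (\rank (X *m _) <= _)%N]mulmxA.
by rewrite (leq_trans (mxrankM_maxl _ _))// mxrankM_maxr.
Qed.

Lemma mulmx_tr_enorm n (v : 'rV[R]_n) : v *m v^T = (enorm v ^+ 2)%:M.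
Proof.
apply/matrixP => i j; rewrite !ord1 enorm_sqr !mxE eqxx mulr1n.
by apply: eq_bigr => l _; rewrite !mxE expr2.
Qed.

(* Deflation: peel off the unit vector v of a non-zero row of P; the remainder
   P - v^T v is again a projection, of smaller rank. *)
Lemma projection_onb n (P : 'M[R]_n) : P^T = P -> P *m P = P ->
  exists m, exists U : 'M[R]_(m, n), U *m U^T = 1%:M /\ U^T *m U = P.
Proof.
move: {2}(\rank P).+1 (ltnSn (\rank P)) => r.
elim: r P => // r IH P rP PT PP.
have [P0|P0] := eqVneq P 0.
  exists 0%N, 0; split; first by apply/matrixP => -[].
  by rewrite mulmx0 P0.
have [i Pi] : exists i, row i P != 0.
  apply/existsP; apply: contraNT P0; rewrite negb_exists => /forallP h.
  by apply/eqP/row_matrixP => i; rewrite row0; apply/eqP; have := h i; rewrite negbK.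
pose v := (enorm (row i P))^-1 *: row i P.
have e0 : 0 < enorm (row i P) by rewrite enorm_gt0.
have vP : v *m P = v by rewrite /v -scalemxAl -row_mul PP.
have PvT : P *m v^T = v^T by rewrite -{1}PT -trmx_mul vP.
have vv : v *m v^T = 1%:M.
  by rewrite mulmx_tr_enorm /v enormZ gtr0_norm ?invr_gt0// mulVf ?gt_eqF// expr1n.
pose Q := P - v^T *m v.
have QT : Q^T = Q by rewrite /Q linearB/= trmx_mul trmxK PT.
have vQ : v *m Q = 0 by rewrite /Q mulmxBr vP mulmxA vv mul1mx subrr.
have QvT : Q *m v^T = 0 by rewrite -QT -trmx_mul vQ trmx0.
have PQ : P *m Q = Q by rewrite /Q mulmxBr PP mulmxA PvT.
have QQ : Q *m Q = Q by rewrite {1}/Q mulmxBl PQ -mulmxA vQ mulmx0 subr0.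
have rQ : (\rank Q < r)%N.
  apply: (@leq_trans (\rank P)); last by rewrite -ltnS.
  have QP : (Q <= P)%MS by rewrite -QT -PQ trmx_mul PT submxMl.
  apply: rank_ltmx; rewrite ltmxE QP/=.
  (* Strictness: v lies in the row space of P. If it were w Q, then v v^T = w Q v^T = 0, against v
     v^T = 1. *)
  apply/negP => PleQ; have /submxP[w vE] : (v <= Q)%MS.
    by apply: submx_trans PleQ; rewrite -vP submxMl.
  have /matrixP/(_ ord0 ord0)/eqP := vv; rewrite {1}vE -mulmxA QvT mulmx0 !mxE.
  by rewrite eqxx eq_sym oner_eq0.
have [m [U [UU UQ]]] := IH Q rQ QT QQ.
exists (1 + m)%N, (col_mx v U).
have Uv : U *m v^T = 0.
  by rewrite -[U]mul1mx -UU -!mulmxA (mulmxA U^T) UQ QvT mulmx0.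
rewrite tr_col_mx mul_col_row vv UU Uv -[v *m U^T]trmxK trmx_mul trmxK Uv trmx0.
split; first by rewrite scalar_mx_block.
by rewrite mul_row_col UQ /Q addrC subrK.
Qed.

(** Rules out the default value 0 of [xget]: deflation supplies an orthonormal family, and the rank
    of P forces its size to be m. *)
Lemma onbP n m (P : 'M[R]_n) : Gr n m P ->
  onb m P *m (onb m P)^T = 1%:M /\ (onb m P)^T *m onb m P = P.
Proof.
move=> [PT [PP rP]]; have [m' [U [UU UP]]] := projection_onb PT PP.
have mm : m' = m by rewrite -rP -UP orthonormal_rank.
move: U UU UP; rewrite mm => U UU UP.
by apply: (xgetPex 0 (P := [set U : 'M[R]_(m, n) | U *m U^T = 1%:M /\ U^T *m U = P])); exists U.
Qed.

Lemma enorm_orthonormal n m (U : 'M[R]_(m, n)) (x : 'rV[R]_m) :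
  U *m U^T = 1%:M -> enorm (x *m U) = enorm x.
Proof.
move=> UU; apply/eqP; rewrite -(eqrXn2 (n := 2)) ?enorm_ge0//; apply/eqP.
have := mulmx_tr_enorm (x *m U); rewrite trmx_mul mulmxA -(mulmxA x) UU mulmx1.
by rewrite mulmx_tr_enorm => /matrixP/(_ ord0 ord0); rewrite !mxE eqxx !mulr1n.
Qed.

(** On orthogonal projections rank and trace agree, as tr(U^T U) = tr(U U^T). Unlike the rank, the
    trace is continuous, so the Grassmannian becomes a closed set cut out by polynomial
    equations. *)
Lemma Gr_trace n m : Gr (R := R) n m =
  [set P | P^T = P /\ P *m P = P /\ \tr P = m%:R].
Proof.
apply/seteqP; split => P [PT [PP h]]; do 2 split=> //;
  have [m' [U [UU UP]]] := projection_onb PT PP;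
  have rE : \rank P = m' by rewrite -UP orthonormal_rank.
  by rewrite -UP mxtrace_mulC UU mxtrace1 -rE h.
by move/eqP: h; rewrite -UP mxtrace_mulC UU mxtrace1 eqr_nat => /eqP <-; rewrite UP.
Qed.

Lemma closed_Gr n m : closed (Gr (R := R) n m).
Proof.
rewrite Gr_trace [X in closed X](_ : _ =
  (\bigcap_(ij in [set: 'I_n * 'I_n]) [set P : 'M[R]_n | P ij.2 ij.1 - P ij.1 ij.2 = 0]) `&`
  (\bigcap_(ij in [set: 'I_n * 'I_n])
     [set P : 'M[R]_n | \sum_l P ij.1 l * P l ij.2 - P ij.1 ij.2 = 0]) `&`
  [set P : 'M[R]_n | \sum_l P l l = m%:R]).
  have c1 (h : 'M[R]_n -> R) a : continuous h -> closed [set P | h P = a].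
    by move=> ch; apply: (@preimage_closed _ _ h [set a]) => //; exact: closed_eq.
  apply: closedI; first apply: closedI.
  - apply: closed_bigI => -[i j] _; apply: c1 => P; apply: continuousB; exact: coord_continuous.
  - apply: closed_bigI => -[i j] _; apply: c1 => P.
    apply: continuousB; last exact: coord_continuous.
    by apply: (cvg_big add_continuous (F := nbhs P)) => l _; apply: cvgM; exact: coord_continuous.
  - by apply: c1 => P; apply: (cvg_big add_continuous (F := nbhs P)) => l _; exact: coord_continuous.
apply/seteqP; split => P /=.
  move=> [PT [PP tP]]; split => //; split => -[i j] _ /=.
    by rewrite -[in X in X - _]PT mxE subrr.
  by rewrite -[in X in _ - X]PP mxE subrr.
move=> [[h1 h2] h3]; split; [|split => //]; apply/matrixP => i j; rewrite mxE.
  by apply/eqP; rewrite -subr_eq0; apply/eqP; exact: (h1 (i, j)).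
by apply/eqP; rewrite -subr_eq0; apply/eqP; exact: (h2 (i, j)).
Qed.

Lemma measurable_Gr n m : measurable (Gr (R := R) n m : set (BorelM n)).
Proof.
rewrite -[Gr _ _]setCK; apply: measurableC; apply: sub_sigma_algebra.
by apply: closed_openC; exact: closed_Gr.
Qed.

End Grassmannian.

(** * Star bodies *)

Section StarBody.
Variables (R : realType) (n : nat) (K : set 'rV[R]_n).

Lemma compact_coord_bounded : compact K ->
  exists2 M : R, 0 < M & forall x, K x -> forall i, `|x ord0 i| <= M.
Proof.
move=> cK.
have bnd i : exists2 M : R, 0 < M & forall x, K x -> `|x ord0 i| <= M.
  have cf : compact ((fun x : 'rV[R]_n => x ord0 i) @` K).
    by apply: continuous_compact => //; apply: continuous_subspaceT; exact: coord_continuous.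
  have [M0 [_ hM]] := compact_bounded cf.
  have M1 : 0 < `|M0| + 1 by rewrite ltr_wpDl.
  exists (`|M0| + 1) => // x Kx; apply: (hM (`|M0| + 1)); last by exists x.
  by rewrite (le_lt_trans (ler_norm _))// ltrDl.
have [M MP] := choice (fun i => let: ex_intro2 M a b := bnd i in ex_intro _ M (conj a b)).
exists (1 + \sum_i M i).
  by rewrite ltr_wpDr// sumr_ge0// => i _; rewrite ltW//; have [] := MP i.
move=> x Kx i; have [_ /(_ x Kx) h] := MP i; rewrite (le_trans h)//.
rewrite (bigD1 i)//= addrCA lerDl addr_ge0// sumr_ge0// => j _.
by rewrite ltW//; have [] := MP j.
Qed.

Lemma continuous_scale_row (y : 'rV[R]_n) : continuous (fun t : R => t *: y).
Proof. by move=> t; apply: cvgZl => //; exact: cvg_id. Qed.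

Hypothesis starK : star_body K.

Let cK : compact K. Proof. by case: starK. Qed.

Lemma star_closed : closed K.
Proof. by apply: compact_closed cK; exact: norm_hausdorff. Qed.

Lemma star_nbhs0 : nbhs (0 : 'rV[R]_n) K. Proof. by case: starK. Qed.

Lemma star0 : K 0. Proof. exact: nbhs_singleton star_nbhs0. Qed.

Lemma closed_ray (y : 'rV[R]_n) : closed [set t : R | K (t *: y)].
Proof.
apply: (@preimage_closed _ _ (fun t : R => t *: y) K); last exact: star_closed.
by move=> t _; exact: continuous_scale_row.
Qed.

Lemma ray_near0 (y : 'rV[R]_n) :
  exists2 d : R, 0 < d & forall t, `|t| < d -> K (t *: y).
Proof.
have : nbhs (0 : R) [set t | K (t *: y)].
  by apply: continuous_scale_row; rewrite scale0r; exact: star_nbhs0.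
move=> /nbhs_ballP[d /= d0 h]; exists d => // t td; apply: h.
by rewrite /ball/= sub0r normrN.
Qed.

Lemma ray_bounded (y : 'rV[R]_n) : y != 0 ->
  exists2 M : R, 0 < M & forall t, K (t *: y) -> `|t| <= M.
Proof.
move=> y0; have [i yi] : exists i, y ord0 i != 0.
  apply/existsP; apply: contraNT y0; rewrite negb_exists => /forallP h.
  by apply/eqP/rowP => i; rewrite mxE; apply/eqP; have := h i; rewrite negbK.
have [M M0 MP] := compact_coord_bounded cK.
exists (M / `|y ord0 i|); first by rewrite divr_gt0// normr_gt0.
move=> t /MP/(_ i); rewrite mxE normrM => h.
by rewrite ler_pdivlMr// normr_gt0.
Qed.

Let boundary := closure K `\` interior K.

(** s is the supremum of the times in [0, b] at which the ray is in K. Closedness puts the exit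
    point in K, hence s < b; were it interior, slightly later times would still be in K. Positivity
    of s uses that 0 is interior to K. *)
Lemma exit_point (y : 'rV[R]_n) (b : R) : 0 <= b -> ~ K (b *: y) ->
  exists s, [/\ 0 < s, s < b, boundary (s *: y) &
                forall t, 0 <= t <= b -> K (t *: y) -> t <= s].
Proof.
move=> b0 Nb; pose S := [set t | 0 <= t <= b /\ K (t *: y)].
have S0 : S 0 by split; [rewrite lexx b0|rewrite scale0r; exact: star0].
have ubS : ubound S b by move=> t [/andP[]].
have supS : has_sup S by split; [exists 0|exists b].
have Sle t : S t -> t <= sup S by move=> St; exact: sup_upper_bound.
have Ks : K (sup S *: y).
  apply: (@closed_ray y) => B /nbhs_ballP[e /= e0 eB].
  have [t St st] := sup_adherent e0 supS.
  exists t; split; first by case: St.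
  apply: eB; rewrite /ball/= ger0_norm ?subr_ge0 ?Sle//.
  by rewrite ltrBlDl -ltrBlDr.
have sb : sup S < b.
  rewrite lt_neqAle; apply/andP; split; last by apply: ge_sup; [exists 0|].
  by apply/eqP => sE; apply: Nb; rewrite -sE.
have b_gt0 : 0 < b by apply: le_lt_trans sb; exact: Sle.
exists (sup S); split => //.
- have [d d0 dK] := ray_near0 y.
  pose t := Num.min (d / 2) b.
  have t0 : 0 < t by rewrite lt_min divr_gt0//.
  apply: (lt_le_trans t0); apply: (Sle _); split; first by rewrite ltW//= ge_min lexx orbT.
  apply: dK; rewrite gtr0_norm// gt_min; apply/orP; left.
  by rewrite ltr_pdivrMr// ltr_pMr// ltr1n.
- split; first exact: subset_closure.
  move=> /(continuous_scale_row (y:=y) (x:=sup S)) /nbhs_ballP[e /= e0 eK].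
  pose t := Num.min (sup S + e / 2) b.
  have st : sup S < t by rewrite lt_min sb ltrDl divr_gt0.
  suff : t <= sup S by rewrite leNgt st.
  apply: (Sle _); split.
    by rewrite (le_trans (Sle _ S0) (ltW st))/= ge_min lexx orbT.
  apply: eK; rewrite /ball/= ltr0_norm ?subr_lt0// opprB ltrBlDl gt_min.
  by apply/orP; left; rewrite ltrD2l ltr_pdivrMr// ltr_pMr// ltr1n.
- by move=> t tb Kt; apply: (Sle _).
Qed.

(* A gap of K on the segment from 0 to y would produce three boundary points on
   the line through y. *)
Lemma star_shaped (y : 'rV[R]_n) (t : R) : K y -> 0 <= t <= 1 -> K (t *: y).
Proof.
move=> Ky /andP[t0 t1]; apply: contrapT => NK.
have y0 : y != 0 by apply: contra_notN NK => /eqP ->; rewrite scaler0; exact: star0.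
have t1' : t < 1.
  by rewrite lt_neqAle t1 andbT; apply: contra_notN NK => /eqP ->; rewrite scale1r.
have [s1 [s10 s1t bs1 _]] := exit_point t0 NK.
have [M M0 MP] := ray_bounded y0.
(* M + 2 exceeds every time at which the line is in K, so the endpoint of the search is outside K,
   and it exceeds the time 1 of y itself, so the exit found satisfies s2 >= 1. *)
have M2 : 0 <= M + 2 by rewrite addr_ge0// ltW.
have [s2 [s20 _ bs2 hs2]] : exists s, [/\ 0 < s, s < M + 2, boundary (s *: y) &
                forall t, 0 <= t <= M + 2 -> K (t *: y) -> t <= s].
  by apply: exit_point => // /MP; rewrite ger0_norm//; lra.
have s21 : 1 <= s2 by apply: hs2; rewrite ?scale1r//; apply/andP; split; lra.
have [s3 [s30 _ bs3 _]] : exists s, [/\ 0 < s, s < M + 2, boundary (s *: - y) &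
                forall t, 0 <= t <= M + 2 -> K (t *: - y) -> t <= s].
  by apply: exit_point => //; rewrite scalerN -scaleNr => /MP; rewrite normrN ger0_norm//; lra.
case: starK => _ _ /(_ y y0)[p [q [_ _ _ E]]] _.
have line s : boundary (s *: y) -> s *: y = p \/ s *: y = q.
  move=> bs; have : (boundary `&` [set t *: y | t in [set: R]]) (s *: y).
    by split => //; exists s.
  by rewrite E.
have inj (a b : R) : a *: y = b *: y -> a = b.
  move=> /eqP; rewrite -subr_eq0 -scalerBl scaler_eq0 (negbTE y0) orbF subr_eq0.
  by move/eqP.
rewrite scalerN -scaleNr in bs3.
(* Pigeonhole: the times -s3 < 0 < s1 < 1 <= s2 are distinct, yet their points all lie in {p, q}. *)
have [e1|e1] := line _ bs1; have [e2|e2] := line _ bs2; have [e3|e3] := line _ bs3;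
  try (by (have := inj _ _ (etrans e1 (esym e2)); lra));
  try (by (have := inj _ _ (etrans e1 (esym e3)); lra));
  by (have := inj _ _ (etrans e2 (esym e3)); lra).
Qed.

Lemma mink_has_inf (x : 'rV[R]_n) :
  has_inf [set a : R | 0 <= a /\ exists2 y, K y & x = a *: y].
Proof.
split; last by exists 0 => a [].
have [d d0 dK] := ray_near0 x.
exists (2 / d); split; first by rewrite divr_ge0// ltW.
exists ((d / 2) *: x).
  by apply: dK; rewrite ger0_norm ?divr_ge0 1?ltW// ltr_pdivrMr// ltr_pMr// ltr1n.
by rewrite scalerA -invf_div mulVf ?scale1r// mulf_neq0// ?invr_neq0// gt_eqF.
Qed.

Lemma mink_le (x : 'rV[R]_n) (r : R) : 0 < r -> K (r *: x) -> mink K x <= r^-1.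
Proof.
move=> r0 Krx; apply: ge_inf; first by case: (mink_has_inf x).
split; first by rewrite invr_ge0 ltW.
by exists (r *: x) => //; rewrite scalerA mulVf ?scale1r// gt_eqF.
Qed.

Lemma mink_gt0 (x : 'rV[R]_n) : x != 0 -> 0 < mink K x.
Proof.
move=> x0; have [M M0 MP] := ray_bounded x0.
apply: (@lt_le_trans _ _ M^-1); first by rewrite invr_gt0.
apply: lb_le_inf; first by case: (mink_has_inf x).
move=> a [a0 [y Ky xE]].
have a_neq0 : a != 0 by apply: contraNneq x0 => a0'; rewrite xE a0' scale0r.
have a_gt0 : 0 < a by rewrite lt_neqAle eq_sym a_neq0.
have := MP a^-1; rewrite xE scalerA mulVf// scale1r => /(_ Ky).
by rewrite ger0_norm ?invr_ge0// => h; rewrite invf_ple.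
Qed.

(** Strictly below the radius, the infimum defining [mink] provides a point of K further out on the
    ray, and star-shapedness contracts it. The endpoint is a limit of such points and K is
    closed. *)
Lemma star_in (x : 'rV[R]_n) (r : R) : x != 0 -> 0 <= r <= (mink K x)^-1 -> K (r *: x).
Proof.
move=> x0 /andP[r0 rm]; have m0 := mink_gt0 x0.
have lt_case (t : R) : 0 <= t < (mink K x)^-1 -> K (t *: x).
  move=> /andP[]; rewrite le_eqVlt => /orP[/eqP <- _|t0 tm].
    by rewrite scale0r; exact: star0.
  have : mink K x < t^-1 by rewrite -invf_pgt// posrE.
  move=> /(inf_lt (mink_has_inf x).1)[a [a0 [y Ky xE]] at1].
  rewrite xE scalerA; apply: star_shaped => //.
  apply/andP; split; first by rewrite mulr_ge0// ltW.
  by rewrite mulrC -ler_pdivlMr// div1r ltW.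
apply: (@closed_ray x) => B /nbhs_ballP[e /= e0 eB].
move: r0; rewrite le_eqVlt => /orP[/eqP r0|r0].
  by exists r; split; [rewrite /= -r0 scale0r; exact: star0|apply: eB; exact: ballxx].
pose t := Num.max 0 (r - e / 2).
have tr : t < r by rewrite gt_max r0 gtrBl divr_gt0.
exists t; split; first by apply: lt_case; rewrite le_max lexx/= (lt_le_trans tr).
apply: eB; rewrite /ball/= gtr0_norm ?subr_gt0// ltrBlDl -ltrBlDr lt_max.
by apply/orP; right; rewrite ltrD2l ltrN2 ltr_pdivrMr// ltr_pMr// ltr1n.
Qed.

End StarBody.

(** * Volumes *)

Section Volumes.
Variable R : realType.
Local Notation mu := (@lebesgue_measure R).

(** A product of one-variable indicators, so that the iterated integral factorizes; cubes serve as
    the reference sets for bounding volumes from both sides. *)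
Definition cube_ind (c : R) (m : nat) (x : nat -> R) : R :=
  \prod_(i < m) \1_(`[- c, c]%classic) (x i).

Lemma cube_ind_ge0 c m x : 0 <= cube_ind c m x.
Proof. by apply: prodr_ge0 => i _; rewrite indicE ler0n. Qed.

Lemma measurable_cube_ind c m :
  measurable_fun setT (fun x : coordType R => cube_ind c m x).
Proof.
apply: measurable_prod => i _.
apply: (measurableT_comp (f := (\1_(`[- c, c]%classic) : R -> R))).
  exact: measurable_indic.
exact: measurable_coord.
Qed.

Lemma iint_cube_ind (c : R) m : 0 < c ->
  iint m (fun x => (cube_ind c m x)%:E) = ((2 * c) ^+ m)%:E.
Proof.
move=> c0; elim: m => [|m IH]; first by rewrite /= /cube_ind big_ord0.
rewrite iintS.
transitivity (\int[mu]_t (((2 * c) ^+ m)%:E * (\1_(`[- c, c]%classic) t)%:E))%E.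
  apply: eq_integral => t _; rewrite -IH muleC -iintZl//; last 2 first.
  - by apply/measurable_EFinP; exact: measurable_cube_ind.
  - by move=> x; rewrite lee_fin cube_ind_ge0.
  apply: eq_iint => x; rewrite -EFinM /cube_ind big_ord_recr/= mulrC; congr (_ * _)%:E.
    by rewrite /upd eqxx.
  by apply: eq_bigr => i _; rewrite /upd ltn_eqF.
rewrite ge0_integralZl_EFin//; last 2 first.
- by apply/measurable_EFinP; exact: measurable_indic.
- by rewrite exprn_ge0// mulr_ge0// ltW.
rewrite integral_indic//= setIT.
transitivity (((2 * c) ^+ m)%:E * mu `[(- c)%R, c]%classic)%E => //.
rewrite lebesgue_measure_itv/= lte_fin gtrN//.
by rewrite -EFinD opprK -EFinM exprSr mulr2n mulrDl !mul1r.
Qed.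

(** [vol] is a [fine], which reads an infinite integral as 0; comparison with a cube shows that
    volumes of bounded sets are genuine. *)
Lemma leb_int_indic_lty m (A : set 'rV[R]_m) (M : R) :
  measurable (A : set (borelV R m)) -> 0 < M ->
  (forall x, A x -> forall i, `|x ord0 i| <= M) ->
  (leb_int (fun x => (\1_A x)%:E) < +oo)%E.
Proof.
move=> mA M0 AM; apply: (@le_lt_trans _ _ ((2 * M) ^+ m)%:E); last by rewrite ltry.
rewrite -iint_cube_ind//; apply: le_iint.
- by apply: (@measurable_row_comp R m (fun x => (\1_A (x : 'rV[R]_m))%:E));
    apply/measurable_EFinP; exact: measurable_indic.
- by apply/measurable_EFinP; exact: measurable_cube_ind.
- by move=> x; rewrite lee_fin.
move=> x; rewrite lee_fin [X in X <= _]indicE.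
case: (boolP (_ \in A)); last by rewrite cube_ind_ge0.
rewrite inE => /AM h; rewrite /cube_ind big1// => i _.
by rewrite indicE mem_set//= in_itv/= -ler_norml; have := h i; rewrite mxE.
Qed.

(** A neighbourhood of 0 contains a cube of half-width e/2. Positivity is what later permits
    division by volumes. *)
Lemma leb_int_indic_gt0 m (A : set 'rV[R]_m) :
  measurable (A : set (borelV R m)) -> nbhs (0 : 'rV[R]_m) A ->
  (0 < leb_int (fun x => (\1_A x)%:E))%E.
Proof.
move=> mA /nbhs_ballP[e /= e0 eA].
have c0 : 0 < e / 2 by rewrite divr_gt0.
apply: (@lt_le_trans _ _ ((2 * (e / 2)) ^+ m)%:E).
  by rewrite lte_fin exprn_gt0// mulr_gt0.
rewrite -iint_cube_ind//; apply: le_iint.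
- by apply/measurable_EFinP; exact: measurable_cube_ind.
- by apply: (@measurable_row_comp R m (fun x => (\1_A (x : 'rV[R]_m))%:E));
    apply/measurable_EFinP; exact: measurable_indic.
- by move=> x; rewrite lee_fin cube_ind_ge0.
move=> x; rewrite lee_fin.
have [h|/existsNP[i hi]] := pselect (forall i : 'I_m, x i \in `[- (e / 2), e / 2]); last first.
  by rewrite /cube_ind (bigD1 i)//= indicE memNset// mul0r.
rewrite [X in _ <= X]indicE mem_set; last first.
  apply: eA; split=> // i j; rewrite !mxE /ball/= sub0r normrN.
  have := h j; rewrite in_itv/= -ler_norml => /le_lt_trans; apply.
  by rewrite ltr_pdivrMr// ltr_pMr// ltr1n.
by rewrite /cube_ind big1// => i _; rewrite indicE mem_set//=; exact: h.
Qed.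

Lemma closed_ball2 m : closed (@ball2 R m).
Proof.
apply: (@preimage_closed _ _ (@enorm R m) [set r | r <= 1]); last exact: closed_le.
by move=> x _; exact: continuous_enorm.
Qed.

Lemma nbhs_ball2 m : nbhs (0 : 'rV[R]_m) ball2.
Proof.
have : nbhs (0 : 'rV[R]_m) (enorm @^-1` [set r | r < 1]).
  apply: continuous_enorm; apply: open_nbhs_nbhs; split; first exact: open_lt.
  by rewrite /= /enorm big1 ?sqrtr0// => i _; rewrite mxE expr0n.
by apply: filterS => x /= /ltW.
Qed.

Lemma ball2_coord m (x : 'rV[R]_m) : ball2 x -> forall i, `|x ord0 i| <= 1.
Proof.
move=> xb i; rewrite -(ler_pXn2r (n := 2)) ?nnegrE// expr1n real_normK ?num_real//.
apply: (@le_trans _ _ (enorm x ^+ 2)); last by rewrite expr_le1// enorm_ge0.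
by rewrite enorm_sqr (bigD1 i)//= lerDl sumr_ge0// => j _; rewrite sqr_ge0.
Qed.

Lemma vol_ball2E m : leb_int (fun x => (\1_(@ball2 R m) x)%:E) = (vol (@ball2 R m))%:E.
Proof.
have mB : measurable (@ball2 R m : set (borelV R m)).
  by apply: closed_measurableV; exact: closed_ball2.
rewrite /vol fineK// ge0_fin_numE.
  exact: (leb_int_indic_lty mB ltr01 (@ball2_coord m)).
by apply: leb_int_ge0 => x; rewrite lee_fin.
Qed.

Lemma vol_ball2_gt0 m : 0 < vol (@ball2 R m).
Proof.
rewrite -lte_fin -vol_ball2E; apply: leb_int_indic_gt0; last exact: nbhs_ball2.
by apply: closed_measurableV; exact: closed_ball2.
Qed.

Lemma vol_starE m (K : set 'rV[R]_m) : star_body K ->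
  leb_int (fun x => (\1_K x)%:E) = (vol K)%:E.
Proof.
move=> sK.
have mK : measurable (K : set (borelV R m)).
  by apply: closed_measurableV; exact: star_closed.
have [M M0 MP] := compact_coord_bounded (let: And4 c _ _ _ := sK in c).
rewrite /vol fineK// ge0_fin_numE; first exact: (leb_int_indic_lty mK M0).
by apply: leb_int_ge0 => x; rewrite lee_fin.
Qed.

Lemma vol_star_gt0 m (K : set 'rV[R]_m) : star_body K -> 0 < vol K.
Proof.
move=> sK; rewrite -lte_fin -vol_starE//; apply: leb_int_indic_gt0; last exact: star_nbhs0.
by apply: closed_measurableV; exact: star_closed.
Qed.

Lemma leb_int_punctured_ball m : (0 < m)%N ->
  leb_int (fun x : 'rV[R]_m => (if 0 < enorm x <= 1 then 1 else 0)%:E) = (vol (@ball2 R m))%:E.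
Proof.
move=> m0; rewrite -vol_ball2E; apply: leb_int_off0 => //.
- apply/measurable_EFinP; apply: measurable_fun_ifT => //.
  apply: measurable_and.
    by apply: measurable_fun_ltr => //; exact: measurable_enorm.
  by apply: measurable_fun_ler => //; exact: measurable_enorm.
- apply/measurable_EFinP; apply: measurable_indic.
  by apply: closed_measurableV; exact: closed_ball2.
- by move=> x; case: ifP => _; rewrite lee_fin.
move=> x x0; rewrite enorm_gt0 x0/= indicE /ball2.
by case: ifPn => h; [rewrite mem_set | rewrite memNset//=; exact/negP].
Qed.

(** Young's inequality for the pair u^k and 1 with the conjugate exponents n/k and n/(n-k). *)
Lemma young_exprn (n k : nat) (u : R) : (0 < k < n)%N -> 0 <= u ->
  u ^+ k <= k%:R / n%:R * u ^+ n + (n - k)%:R / n%:R.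
Proof.
move=> /andP[k0 kn] u0.
have n0 : (0 < n)%N by exact: ltn_trans kn.
have knz : k%:R != 0 :> R by rewrite pnatr_eq0 -lt0n.
have nnz : n%:R != 0 :> R by rewrite pnatr_eq0 -lt0n.
have nkE : (n - k)%:R = n%:R - k%:R :> R by rewrite natrB// ltnW.
have nk0 : n%:R - k%:R != 0 :> R by rewrite -nkE pnatr_eq0 -lt0n subn_gt0.
have h : u ^+ k * 1 <= (u ^+ k) `^ (n%:R / k%:R) / (n%:R / k%:R) +
    1 `^ (n%:R / (n - k)%:R) / (n%:R / (n - k)%:R).
  apply: conjugate_powR; rewrite ?exprn_ge0 ?divr_gt0 ?ltr0n ?subn_gt0//.
  by rewrite nkE; field; rewrite nk0 knz nnz.
move: h; rewrite mulr1 powR1 -powR_mulrn// -powRrM mulrCA mulfV// mulr1 powR_mulrn//.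
by rewrite [u `^ _]powR_mulrn// !invf_div mul1r [X in _ <= X + _ -> _]mulrC.
Qed.

End Volumes.

(** * The radial function of a star body *)

Section RadialPower.
Variable R : realType.
Local Notation mu := (@lebesgue_measure R).

Lemma integral_exprn (d : nat) (a : R) : (0 < d)%N -> 0 < a ->
  (\int[mu]_(r in `]0%R, a]) (r ^+ d.-1)%:E = (d%:R^-1 * a ^+ d)%:E)%E.
Proof.
move=> d0 a0.
have dnz : d%:R != 0 :> R by rewrite pnatr_eq0 -lt0n.
have cX e : continuous (fun r : R => r ^+ e) by move=> r; exact: exprn_continuous.
rewrite integral_itv_obnd_cbnd; last first.
  by apply: measurable_funTS; apply/measurable_EFinP; exact: measurable_funX.
pose F (r : R) : R := d%:R^-1 * r ^+ d.
have cF : continuous F by move=> r; apply: cvgMr; exact: cX.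
have dF (r : R) : is_derive r 1 F (r ^+ d.-1).
  have h : is_derive r (1 : R) (fun s : R => s ^+ d) ((d%:R * r ^+ d.-1) *: 1).
    have := is_deriveX d (is_derive_id r (1 : R)).
    by rewrite (_ : id ^+ d = (fun s : R => s ^+ d))//; apply/funext => y; rewrite fctE.
  have -> : r ^+ d.-1 = d%:R^-1 *: ((d%:R * r ^+ d.-1) *: 1) :> R.
    by rewrite /GRing.scale/= mulr1 mulKf.
  exact: is_deriveZ.
rewrite (@continuous_FTC2 _ _ F)//.
- by rewrite -EFinD /F expr0n gtn_eqF// mulr0 subr0.
- by apply: continuous_subspaceT; exact: cX.
- split; first by move=> r _; apply: ex_derive.
    by apply: cvg_at_right_filter; exact: cF.
  by apply: cvg_at_left_filter; exact: cF.
- by move=> r _; rewrite derive1E; exact: derive_val.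
Qed.

Variables (n : nat) (K : set 'rV[R]_n).
Hypotheses (n_gt0 : (0 < n)%N) (starK : star_body K).

Let mK : measurable_fun setT ((fun x => (\1_K x)%:E) : borelV R n -> \bar R).
Proof.
apply/measurable_EFinP; apply: measurable_indic.
by apply: closed_measurableV; exact: star_closed.
Qed.

Lemma radial_indic_ge (th : 'rV[R]_n) : th != 0 ->
  ((n%:R^-1 * (mink K th)^-1 ^+ n)%:E <= radial n.-1 (fun x => (\1_K x)%:E) th)%E.
Proof.
move=> th0; have m0 := mink_gt0 starK th0.
rewrite -integral_exprn ?invr_gt0// /radial integral_mkcond.
apply: ge0_le_integral => //.
- by move=> r _; rewrite patchE; case: ifPn => //; rewrite inE/= in_itv/= => /andP[r0 _];
    rewrite lee_fin exprn_ge0// ltW.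
- apply/(measurable_restrictT _ _).1 => //; apply: measurable_funTS.
  by apply/measurable_EFinP; exact: measurable_funX.
- exact: (measurable_radial_integrand mK _ th).
move=> r _; rewrite patchE; case: ifPn => [|_]; last first.
  by case: ifPn => // r0; rewrite -EFinM lee_fin mulr_ge0// exprn_ge0// ltW.
rewrite inE/= in_itv/= => /andP[r0 rm]; rewrite r0 -EFinM lee_fin.
by rewrite indicE mem_set ?mulr1//; apply: star_in => //; rewrite (ltW r0) rm.
Qed.

Definition sphere_fun (g : 'rV[R]_n -> R) (x : 'rV[R]_n) : R :=
  if 0 < enorm x <= 1 then g ((enorm x)^-1 *: x) else 0.

Lemma measurable_ball_if (h : borelV R n -> R) : measurable_fun setT h ->
  measurable_fun setT (fun x : borelV R n => if 0 < enorm (x : 'rV[R]_n) <= 1 then h x else 0).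
Proof.
move=> mh; apply: measurable_fun_ifT => //; apply: measurable_and.
  by apply: measurable_fun_ltr => //; exact: measurable_enorm.
by apply: measurable_fun_ler => //; exact: measurable_enorm.
Qed.

Lemma measurable_mink_sphere k : measurable_fun setT
  (fun x : borelV R n => ((mink K ((enorm (x : 'rV[R]_n))^-1 *: (x : 'rV[R]_n))) ^+ k)^-1).
Proof.
apply: (measurableT_comp (@measurable_invr R)); apply: measurable_funX.
apply: (measurableT_comp (f := (mink K : borelV R n -> R))).
  by apply: continuous_measurableV; case: starK.
apply: measurable_scalerow => //.
by apply: (measurableT_comp (@measurable_invr R)); exact: measurable_enorm.
Qed.

(** One n-th of the surface integral of rho^k, since [sphere_int] carries the factor n. *)
Let W k := leb_int (fun x : 'rV[R]_n =>
  (sphere_fun (fun th => ((mink K th) ^+ k)^-1) x)%:E).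

Let mW k : measurable_fun setT ((fun x : 'rV[R]_n =>
  (sphere_fun (fun th => ((mink K th) ^+ k)^-1) x)%:E) : borelV R n -> \bar R).
Proof.
apply/measurable_EFinP.
exact: (measurable_ball_if (measurable_mink_sphere k)).
Qed.

Lemma normalize_neq0 m (x : 'rV[R]_m) : 0 < enorm x -> (enorm x)^-1 *: x != 0.
Proof.
by move=> x0; rewrite scaler_eq0 negb_or -enorm_gt0 x0 andbT invr_eq0 gt_eqF.
Qed.

Let W0 k x : 0 <= sphere_fun (fun th => ((mink K th) ^+ k)^-1) x.
Proof.
rewrite /sphere_fun; case: ifPn => // /andP[x0 _].
by rewrite invr_ge0 exprn_ge0// ltW// mink_gt0// normalize_neq0.
Qed.

Lemma leb_int_mink_vol : (W n <= (vol K)%:E)%E.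
Proof.
rewrite -vol_starE// (leb_int_polar n_gt0 mK); last by move=> x; rewrite lee_fin.
have nn : 0 <= n%:R^-1 :> R by rewrite invr_ge0.
have -> : W n = (n%:R%:E * (n%:R^-1%:E * W n))%E.
  by rewrite muleA -EFinM mulfV ?mul1e// pnatr_eq0 -lt0n.
rewrite lee_pmul2l ?lte_fin ?ltr0n//.
rewrite -leb_intZl//; last by move=> x; rewrite lee_fin.
apply: le_leb_int.
- exact: measurable_funeM.
- by apply: (measurable_radial_normalized mK) => x; rewrite lee_fin.
- by move=> x; rewrite mule_ge0// lee_fin.
move=> x; rewrite /sphere_fun; case: ifPn => [/andP[x0 _]|_]; last by rewrite mule0.
by rewrite -EFinM -exprVn; apply: radial_indic_ge; exact: normalize_neq0.
Qed.

(** The Hoelder bound is obtained by integrating a pointwise inequality. The number [c] below is the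
    radius of the ball with the volume of K, and the bound is c^k |B|, the value of [W k] for that
    ball. *)
Lemma leb_int_mink_holder k : (0 < k < n)%N ->
  (W k <= (powR (vol K) (k%:R / n%:R) * powR (vol (@ball2 R n)) ((n - k)%:R / n%:R))%:E)%E.
Proof.
move=> /andP[k0 kn]; set V := vol K; set B := vol _.
have V0 : 0 < V by exact: vol_star_gt0.
have B0 : 0 < B by exact: vol_ball2_gt0.
have nnz : n%:R != 0 :> R by rewrite pnatr_eq0 -lt0n.
have nkE : (n - k)%:R = n%:R - k%:R :> R by rewrite natrB// ltnW.
(* Young's inequality applied to rho / c, with the optimal c. *)
pose c := powR (V / B) n%:R^-1.
have c0 : 0 < c by rewrite powR_gt0// divr_gt0.
have cn : c ^+ n = V / B by rewrite -powR_mulrn ?ltW// -powRrM mulVf// powRr1// ltW// divr_gt0.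
have -> : powR V (k%:R / n%:R) * powR B ((n - k)%:R / n%:R) = c ^+ k * B.
  have -> : c ^+ k = powR V (k%:R / n%:R) / powR B (k%:R / n%:R).
    rewrite -powR_mulrn ?ltW// -powRrM [_ * k%:R]mulrC powRM ?invr_ge0 ?ltW//.
    by rewrite -(powR_inv1 (ltW B0)) -[X in _ * X = _]powRrM mulN1r powRN.
  rewrite nkE mulrBl mulfV// powRD; last by apply/implyP => _; rewrite gt_eqF.
  by rewrite powRr1 ?ltW// powRN -mulrA [_^-1 * B]mulrC.
(* Coefficients of Young's inequality for rho/c after multiplication by c^k, giving rho^k <= a rho^n
   + b. As c^n = V/B, the integrated bound a V + b B collapses to c^k B. *)
pose a := c ^+ k * (k%:R / n%:R) / c ^+ n.
pose b := c ^+ k * ((n - k)%:R / n%:R).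
have a0 : 0 <= a by rewrite !mulr_ge0// ?invr_ge0 ?exprn_ge0// ltW.
have b0 : 0 <= b by rewrite !mulr_ge0// ?invr_ge0 ?exprn_ge0// ltW.
apply: (@le_trans _ _ (leb_int (fun x : 'rV[R]_n =>
   (a%:E * (sphere_fun (fun th => ((mink K th) ^+ n)^-1) x)%:E +
   b%:E * (if (0 < enorm x <= 1)%R then 1 else 0)%R%:E)%E))).
  apply: le_leb_int => //.
  - apply: emeasurable_funD; first exact: measurable_funeM.
    by apply: measurable_funeM; apply/measurable_EFinP; exact: measurable_ball_if.
  - by move=> x; rewrite lee_fin.
  move=> x; rewrite -!EFinM -EFinD lee_fin /sphere_fun;
  case: ifPn => [/andP[x0 _]|_]; last by rewrite !mulr0 addr0.
  have := mink_gt0 starK (normalize_neq0 x0); move: (mink K _) => t t0.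
  rewrite -!exprVn.
  have u0 : 0 <= t^-1 / c by apply: divr_ge0; rewrite ?invr_ge0 ltW.
  have h := young_exprn (introT andP (conj k0 kn)) u0.
  have cnz e : c ^+ e != 0 by rewrite expf_neq0// gt_eqF.
  have -> : t^-1 ^+ k = c ^+ k * (t^-1 / c) ^+ k.
    by rewrite exprMn [c^-1 ^+ k]exprVn mulrCA mulfV// mulr1.
  have -> : a * t^-1 ^+ n + b * 1 = c ^+ k *
      (k%:R / n%:R * (t^-1 / c) ^+ n + (n - k)%:R / n%:R).
    rewrite /a /b exprMn [c^-1 ^+ n]exprVn.
    by field; rewrite nnz (cnz n).
  by rewrite ler_pM2l// exprn_gt0.
rewrite leb_intD; last 4 first.
- exact: measurable_funeM.
- by apply: measurable_funeM; apply/measurable_EFinP; exact: measurable_ball_if.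
- by move=> x; rewrite mule_ge0// lee_fin.
- by move=> x; rewrite mule_ge0// lee_fin; case: ifP.
rewrite !leb_intZl//; last 3 first.
- by apply/measurable_EFinP; exact: measurable_ball_if.
- by move=> x; rewrite lee_fin; case: ifP.
- by move=> x; rewrite lee_fin.
rewrite leb_int_punctured_ball//.
apply: (@le_trans _ _ (a%:E * V%:E + b%:E * B%:E)%E).
  by rewrite leeD2r// lee_wpmul2l//; exact: leb_int_mink_vol.
rewrite -!EFinM -EFinD lee_fin /a /b cn nkE le_eqVlt; apply/orP; left; apply/eqP.
by field; rewrite nnz !gt_eqF.
Qed.

End RadialPower.

(** * Continuity of weighted radial integrals *)

Section RadialContinuity.
Variables (R : realType) (n : nat) (K : set 'rV[R]_n) (f : 'rV[R]_n -> R).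
Hypotheses (starK : star_body K) (cf : {within K, continuous f}).
Hypothesis f0 : forall x, K x -> 0 <= f x.
Local Notation mu := (@lebesgue_measure R).

Let phi (x : 'rV[R]_n) : R := \1_K x * f x.

Let phi0 x : 0 <= phi x.
Proof.
rewrite /phi indicE; case: (boolP (x \in K)); last by rewrite mul0r.
by rewrite inE mul1r; exact: f0.
Qed.

Let mphi : measurable_fun setT (phi : borelV R n -> R).
Proof. by apply: within_continuous_measurableV => //; exact: star_closed. Qed.

Let mphiE : measurable_fun setT ((fun x => (phi x)%:E) : borelV R n -> \bar R).
Proof. exact/measurable_EFinP. Qed.

Let phi_bounded : exists2 M : R, 0 < M & forall x, phi x <= M.
Proof.
have cfK : compact (f @` K) by apply: continuous_compact => //; case: starK.
have [M0 [_ hM]] := compact_bounded cfK.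
exists (`|M0| + 1); first by rewrite ltr_wpDl.
move=> x; rewrite /phi indicE; case: (boolP (x \in K)); last first.
  by rewrite mul0r addr_ge0.
rewrite inE mul1r => Kx; apply: (le_trans (ler_norm _)).
apply: (hM (`|M0| + 1)); last by exists x.
by rewrite (le_lt_trans (ler_norm _))// ltrDl.
Qed.

(** The substitution r = s / [mink K th] replaces the radius range, which varies with the direction,
    by the fixed interval [0, 1]; all dependence on [th] moves into the integrand. *)
Let ray (th : 'rV[R]_n) (s : R) : 'rV[R]_n := (s / mink K th) *: th.

Let ray_in th s : th != 0 -> 0 <= s <= 1 -> K (ray th s).
Proof.
move=> th0 /andP[s0 s1]; have m0 := mink_gt0 starK th0.
apply: star_in => //; apply/andP; split; first by rewrite divr_ge0// ltW.
by rewrite ler_pdivrMr// mulVf ?gt_eqF.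
Qed.

Let slice (e : nat) th (s : R) : R := if 0 < s <= 1 then s ^+ e * phi (ray th s) else 0.

Let slice_ge0 e th s : 0 <= slice e th s.
Proof.
by rewrite /slice; case: ifPn => // /andP[s0 _]; rewrite mulr_ge0// exprn_ge0// ltW.
Qed.

Let m01 : measurable_fun setT (fun s : measurableTypeR R => (0 < (s : R) <= 1)).
Proof.
apply: measurable_and; first exact: (@measurable_fun_ltr _ _ R).
exact: (@measurable_fun_ler _ _ R).
Qed.

Let mslice e th : measurable_fun setT (fun s : measurableTypeR R => (slice e th s)%:E).
Proof.
apply/measurable_EFinP; apply: measurable_fun_ifT => //.
apply: measurable_funM; first exact: measurable_funX.
apply: (measurableT_comp mphi).
apply: (@measurable_scalerow R n _ _ (fun s : measurableTypeR R => s / mink K th) (cst th)) => //.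
exact: measurable_funM.
Qed.

Let I e th : \bar R := (\int[mu]_s (slice e th s)%:E)%E.

Let radialI e th : th != 0 ->
  radial e (fun x => (phi x)%:E) th = (((mink K th)^-1 ^+ e.+1)%:E * I e th)%E.
Proof.
move=> th0; have m0 := mink_gt0 starK th0.
have r0 : 0 < (mink K th)^-1 by rewrite invr_gt0.
rewrite /radial (ge0_integral_scale r0); last 2 first.
- exact: (measurable_radial_integrand mphiE).
- by move=> r; case: ifPn => // r1; rewrite -EFinM lee_fin mulr_ge0// exprn_ge0// ltW.
rewrite exprS EFinM -muleA; congr (_ * _)%E.
rewrite -ge0_integralZl_EFin ?exprn_ge0 1?ltW//; last first.
  by move=> s _; rewrite lee_fin.
apply: eq_integral => s _; rewrite pmulr_rgt0// /slice.
case: (ltP 0 s) => s0 /=; last by rewrite mule0.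
rewrite -!EFinM exprMn -mulrA mulrC; congr (_%:E).
case: ifPn => s1; first by rewrite /ray [s / _]mulrC; ring.
(* For s > 1 the point is outside K: membership would give [mink K th] <= [mink K th] / s. *)
suff -> : phi ((mink K th)^-1 * s *: th) = 0 by ring.
rewrite /phi indicE memNset ?mul0r// => /(mink_le starK _).
rewrite mulr_gt0// => /(_ isT); rewrite invfM invrK.
by rewrite -[X in X <= _]mulr1 ler_pM2l// invf_ge1// (negbTE s1).
Qed.

Let I_fin e th : I e th \is a fin_num.
Proof.
have [M M0 MP] := phi_bounded.
rewrite ge0_fin_numE; last by apply: integral_ge0 => s _; rewrite lee_fin.
apply: (@le_lt_trans _ _ (\int[mu]_s (M%:E * (\1_(`]0, 1]%classic) s)%:E))%E).
  apply: ge0_le_integral => //.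
  - by move=> s _; rewrite lee_fin.
  - apply: measurable_funeM; apply/measurable_EFinP; exact: measurable_indic.
  move=> s _; rewrite -EFinM lee_fin /slice indicE; case: ifPn => [s01|_]; last first.
    by rewrite mulr_ge0// ltW.
  rewrite mem_set/= ?in_itv// mulr1; case/andP: s01 => s0 s1.
  by rewrite -[M]mul1r ler_pM// ?exprn_ge0 ?exprn_ile1// ltW.
rewrite ge0_integralZl_EFin//; last 2 first.
- by apply/measurable_EFinP; exact: measurable_indic.
- exact: ltW.
rewrite integral_indic//= setIT.
rewrite (_ : lebesgue_measure _ = 1%:E) ?mule1 ?ltry//.
by transitivity (mu `]0%R, 1%R]%classic) => //;
  rewrite lebesgue_measure_itv/= lte_fin ltr01 -EFinB subr0.
Qed.

(** The error d is integrated against s^e <= 1 over an interval of length 1. The bound is one-sided;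
    using it for both orders of the directions yields continuity of I. *)
Let I_close e th th' (d : R) : 0 <= d ->
  (forall s, 0 <= s <= 1 -> phi (ray th s) <= phi (ray th' s) + d) ->
  fine (I e th) <= fine (I e th') + d.
Proof.
move=> d0 h; rewrite -lee_fin EFinD !fineK//.
apply: (@le_trans _ _ (\int[mu]_s ((slice e th' s)%:E + d%:E * (\1_(`]0, 1]%classic) s)%:E))%E).
  apply: ge0_le_integral => //.
  - by move=> s _; rewrite lee_fin.
  - apply: emeasurable_funD => //.
    by apply: measurable_funeM; apply/measurable_EFinP; exact: measurable_indic.
  move=> s _; rewrite -EFinM -EFinD lee_fin /slice indicE; case: ifPn => [s01|_]; last first.
    by rewrite add0r mulr_ge0.
  rewrite mem_set/= ?in_itv// mulr1; case/andP: s01 => s0 s1.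
  have se : 0 <= s ^+ e by rewrite exprn_ge0// ltW.
  apply: (@le_trans _ _ (s ^+ e * (phi (ray th' s) + d))).
    by rewrite ler_wpM2l// h// ltW.
  by rewrite mulrDr lerD2l -[X in _ <= X]mul1r ler_wpM2r// exprn_ile1// ltW.
rewrite ge0_integralD//; last 3 first.
- by move=> s _; rewrite lee_fin.
- by move=> s _; rewrite -EFinM lee_fin mulr_ge0.
- by apply: measurable_funeM; apply/measurable_EFinP; exact: measurable_indic.
apply: leeD2l.
rewrite ge0_integralZl_EFin//; last first.
  by apply/measurable_EFinP; exact: measurable_indic.
rewrite integral_indic//= setIT.
rewrite (_ : lebesgue_measure _ = 1%:E) ?mule1//.
by transitivity (mu `]0%R, 1%R]%classic) => //;
  rewrite lebesgue_measure_itv/= lte_fin ltr01 -EFinB subr0.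
Qed.


Let cmink : continuous (mink K). Proof. by case: starK. Qed.

Let sphere_neq0 (th : 'rV[R]_n) : sphere n th -> th != 0.
Proof. by move=> thS; rewrite -enorm_gt0 thS ltr01. Qed.

(* Continuity of (s, th) |-> phi (ray th s) is uniform in s by compactness of [0, 1]. *)
Let phi_ray_close (th0 : 'rV[R]_n) (d : R) : sphere n th0 -> 0 < d ->
  \forall th \near nbhs th0, sphere n th ->
    forall s, 0 <= s <= 1 -> `|phi (ray th s) - phi (ray th0 s)| < d.
Proof.
move=> th0S d0; have th0N := sphere_neq0 th0S; have m0 := mink_gt0 starK th0N.
have ray_cvg (s0 : R) : ray z.2 z.1 @[z --> filter_prod (nbhs s0) (nbhs th0)] --> ray th0 s0.
  rewrite /ray; apply: cvgZ; last exact: cvg_snd.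
  apply: cvgM; first exact: cvg_fst.
  apply: cvgV; first by rewrite gt_eqF.
  by apply: (@cvg_comp _ _ _ snd (mink K) _ (nbhs th0)); [exact: cvg_snd|exact: cmink].
(* The extension by 0 may be discontinuous at the boundary of K, but these points stay in K, where
   it equals [f] and relative continuity applies. *)
have phiE th s : th != 0 -> 0 <= s <= 1 -> phi (ray th s) = f (ray th s).
  by move=> thN s01; rewrite /phi indicE mem_set ?mul1r//; exact: ray_in.
have key (s0 : R) : 0 <= s0 <= 1 -> \forall z \near filter_prod (nbhs s0) (nbhs th0),
    sphere n z.2 -> 0 <= z.1 <= 1 -> `|phi (ray z.2 z.1) - phi (ray th0 s0)| < d / 2.
  move=> s01; have Kr := ray_in th0N s01.
  have /subspace_continuousP/(_ _ Kr) fc := cf.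
  have : within K (nbhs (ray th0 s0)) [set y | `|f y - f (ray th0 s0)| < d / 2].
    have /fc : nbhs (f (ray th0 s0)) (ball (f (ray th0 s0)) (d / 2)).
      by apply: nbhsx_ballx; rewrite divr_gt0.
    by apply: (@filterS _ (within K (nbhs (ray th0 s0)))) => y; rewrite /ball/= distrC.
  rewrite /within/= => /ray_cvg.
  apply: (@filterS _ (filter_prod (nbhs s0) (nbhs th0))) => -[s th] /= h thS s01'.
  by rewrite !phiE//; [apply: h; apply: ray_in => //|]; exact: sphere_neq0.
have /compact_near_coveringP cov := @segment_compact R 0 1.
have := cov _ (nbhs th0) (fun th s => sphere n th -> 0 <= s <= 1 ->
  `|phi (ray th s) - phi (ray th0 s)| < d) _.
move=> h; have {h} : \forall th \near nbhs th0, `[0, 1]%classic `<=` (fun s => sphere n th ->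
     0 <= s <= 1 -> `|phi (ray th s) - phi (ray th0 s)| < d).
  apply: h => s0; rewrite /= in_itv/= => s01.
  have [[A B] /= [As Bt] AB] := key s0 s01.
  exists (A, B) => //= -[s th] /= [sA thB] thS s01'.
  (* The neighbourhood B contains th0 itself, so the values at (s, th) and at (s, th0) are both
     within d/2 of the value at (s0, th0). *)
  have h1 := AB (s, th) (conj sA thB) thS s01'.
  have h2 := AB (s, th0) (conj sA (nbhs_singleton Bt)) th0S s01'.
  rewrite (splitr d) (le_lt_trans (ler_distD (phi (ray th0 s0)) _ _))//.
  by rewrite ltrD// distrC.
by apply: filterS => th h thS s s01; apply: h => //=; rewrite in_itv.
Qed.

Lemma radial_fin e (th : 'rV[R]_n) : th != 0 ->
  radial e (fun x => (\1_K x * f x)%:E) th \is a fin_num.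
Proof. by move=> th0; rewrite radialI// fin_numM. Qed.

(** Makes g an admissible test function in the identity defining nu. By [radial_fin] the [fine]
    loses nothing on the sphere. *)
Lemma continuous_radial e :
  {within sphere n, continuous (fun th => fine (radial e (fun x => (\1_K x * f x)%:E) th))}.
Proof.
apply/subspace_continuousP => th0 th0S.
have th0N := sphere_neq0 th0S; have m0 := mink_gt0 starK th0N.
have E th : sphere n th -> fine (radial e (fun x => (\1_K x * f x)%:E) th) =
    (mink K th)^-1 ^+ e.+1 * fine (I e th).
  by move=> /sphere_neq0 thN; rewrite radialI// fineM.
suff h : (mink K th)^-1 ^+ e.+1 * fine (I e th) @[th --> within (sphere n) (nbhs th0)] -->
    (mink K th0)^-1 ^+ e.+1 * fine (I e th0).
  rewrite -(E th0 th0S) in h; apply: cvg_trans h; apply: near_eq_cvg.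
  by near=> th; rewrite -E//; near: th; exact: withinT.
apply: cvgM.
  apply: (@continuous_cvg _ R R (within (sphere n) (nbhs th0)) _
    (fun th => (mink K th)^-1) (fun x : R => x ^+ e.+1)); first exact: exprn_continuous.
  apply: cvgV; first by rewrite gt_eqF.
  apply: cvg_within_filter; exact: cmink.
apply/cvgrPdist_le => d d0.
have := phi_ray_close th0S d0; rewrite -[X in X -> _]/(nbhs _ _).
rewrite /prop_near1 /within /=; apply: filterS => th h thS.
have {}h s s01 := ltW (h thS s s01).
rewrite ler_norml; apply/andP; split.
  rewrite lerNl opprB lerBlDl.
  apply: I_close; [exact: ltW|move=> s s01].
  by have := h s s01; rewrite ler_norml => /andP[_]; rewrite lerBlDl.
rewrite lerBlDl; apply: I_close; [exact: ltW|move=> s s01].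
by have := h s s01; rewrite distrC ler_norml => /andP[_]; rewrite lerBlDl.
Unshelve. all: by end_near. Qed.

End RadialContinuity.

(** * Slices *)

(* No measurability of h is needed: the integral of a non-negative function is
   a supremum over the simple functions below it. *)
Lemma le_nnintegral_cst d (T : measurableType d) (R : realType)
    (nu : {measure set T -> \bar R}) (D : set T) (h : T -> \bar R) (c : R) :
  measurable D -> (forall x, D x -> (0 <= h x <= c%:E)%E) ->
  (\int[nu]_(x in D) h x <= c%:E * nu D)%E.
Proof.
move=> mD hc.
have h0 x : D x -> (0 <= h x)%E by move=> /hc/andP[].
have h1 x : D x -> (0 <= cst c%:E x)%E by move=> /hc/andP[]; exact: le_trans.
rewrite -integral_cst// !ge0_integralE//.
apply: ereal_sup_le => _ [s hs <-]; exists s => // x; apply: (le_trans (hs x)).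
rewrite !patchE; case: ifPn => //; rewrite inE => /hc/andP[_]//.
Qed.

Section Slices.
Variables (R : realType) (n k : nat) (K : set 'rV[R]_n) (f : 'rV[R]_n -> R).
Hypotheses (kn : (0 < k < n)%N) (starK : star_body K).
Hypotheses (cf : {within K, continuous f}) (f0 : forall x, K x -> 0 <= f x).
Local Notation mu := (@lebesgue_measure R).
Local Notation m := (n - k)%N.

Let phi (x : 'rV[R]_n) : \bar R := (\1_K x * f x)%:E.
Let g (th : 'rV[R]_n) : R := fine (radial m.-1 phi th).

Let m_gt0 : (0 < m)%N. Proof. by rewrite subn_gt0; case/andP: kn. Qed.
Let n_gt0 : (0 < n)%N. Proof. by case/andP: kn => k0; exact: ltn_trans. Qed.

Let phi0 x : (0 <= phi x)%E.
Proof.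
rewrite lee_fin indicE; case: (boolP (x \in K)); last by rewrite mul0r.
by rewrite inE mul1r; exact: f0.
Qed.

Let mphi : measurable_fun setT (phi : borelV R n -> \bar R).
Proof.
apply/measurable_EFinP.
by apply: within_continuous_measurableV => //; exact: star_closed.
Qed.

Let radial_ge0 e th : (0 <= radial e phi th)%E.
Proof.
apply: integral_ge0 => r _; case: ifPn => // r0; apply: mule_ge0 => //.
by rewrite lee_fin exprn_ge0// ltW.
Qed.

Let gE th : th != 0 -> (g th)%:E = radial m.-1 phi th.
Proof. by move=> th0; rewrite /g fineK//; exact: radial_fin. Qed.

(** Polar coordinates in R^m transported by the isometry y -> y U onto H. The weight [m.-1] in [g]
    is chosen for this: it is the polar density of H. *)
Lemma radon_radial (P : 'M[R]_n) : Gr n m P -> radon m P g = sub_int m P phi.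
Proof.
move=> /onbP[UU _]; rewrite /radon /sub_int; set U := onb m P in UU *.
have mU : measurable_fun setT (fun y : borelV R m => (y : 'rV[R]_m) *m U : borelV R n).
  apply: measurable_fun_rowP => i; under eq_fun do rewrite mxE.
  apply: measurable_sum => j; apply: measurable_funM => //.
  by apply: continuous_measurableV; exact: coord_continuous.
rewrite (@leb_int_polar R m m_gt0
  (fun y : borelV R m => phi ((y : 'rV[R]_m) *m U)))//; last first.
  exact: (measurableT_comp mphi mU).
congr (_ * _)%E; apply: eq_leb_int => y; rewrite !enorm_orthonormal//.
case: ifPn => // /andP[y0 _].
have E : (enorm y)^-1 *: (y *m U) = ((enorm y)^-1 *: y) *m U by rewrite scalemxAl.
rewrite gE; last by rewrite -(enorm_orthonormal y UU) normalize_neq0// enorm_orthonormal.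
by rewrite /radial; apply: eq_integral => r _; rewrite E scalemxAl.
Qed.

Lemma radial_le (th : 'rV[R]_n) : th != 0 ->
  (radial n.-1 phi th <= (((mink K th) ^+ k)^-1 * g th)%:E)%E.
Proof.
move=> th0; have m0 := mink_gt0 starK th0.
rewrite EFinM gE// /radial -ge0_integralZl_EFin//; last 3 first.
- move=> r _; case: ifPn => // r0; apply: mule_ge0 => //.
  by rewrite lee_fin exprn_ge0// ltW.
- exact: (measurable_radial_integrand mphi).
- by rewrite invr_ge0 exprn_ge0// ltW.
apply: ge0_le_integral => //.
- move=> r _; case: ifPn => // r0; apply: mule_ge0 => //.
  by rewrite lee_fin exprn_ge0// ltW.
- exact: (measurable_radial_integrand mphi).
- by apply: measurable_funeM; exact: (measurable_radial_integrand mphi).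
move=> r _; case: ifPn => r0; last by rewrite mule0.
rewrite muleA; have [Kr|NK] := pselect (K (r *: th)); last first.
  have -> : phi (r *: th) = 0%E by rewrite /phi indicE memNset// mul0r.
  by rewrite !mule0 lexx.
apply: lee_wpmul2r => //; rewrite -EFinM lee_fin.
have -> : n.-1 = (k + m.-1)%N.
  by rewrite -[in RHS]subn1 addnBA// subnKC ?subn1// ltnW//; case/andP: kn.
rewrite exprD; apply: ler_wpM2r; first by rewrite exprn_ge0// ltW.
rewrite -exprVn; apply: lerXn2r; rewrite ?nnegrE ?invr_ge0; [exact: ltW|exact: ltW|].
rewrite -(invrK r) lef_pV2 ?posrE ?invr_gt0//.
exact: mink_le.
Qed.

Lemma leb_int_le_sphere :
  (leb_int phi <= sphere_int (fun x => ((mink K x) ^+ k)^-1 * g x)%R)%E.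
Proof.
rewrite (leb_int_polar n_gt0 mphi phi0) /sphere_int; apply: lee_wpmul2l => //.
apply: le_leb_int.
- exact: (measurable_radial_normalized mphi).
(* Replacing [g] by [radial], with which it agrees in non-zero directions, reduces measurability to
   the Tonelli argument for [radial]. *)
- rewrite (_ : (fun x => _) = fun x : borelV R n =>
   ((((mink K ((enorm (x : 'rV[R]_n))^-1 *: (x : 'rV[R]_n))) ^+ k)^-1)%:E *
    (if (0 < enorm (x : 'rV[R]_n) <= 1)%R
     then radial m.-1 phi ((enorm (x : 'rV[R]_n))^-1 *: (x : 'rV[R]_n)) else 0))%E).
    apply: emeasurable_funM; last exact: (measurable_radial_normalized mphi).
    by apply/measurable_EFinP; exact: measurable_mink_sphere.
  apply/funext => x; case: ifPn => [/andP[x0 _]|_]; last by rewrite mule0.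
  by rewrite EFinM gE// normalize_neq0.
- by move=> x; case: ifP.
- move=> x; case: ifPn => // /andP[x0 _].
  by apply: radial_le; exact: normalize_neq0.
Qed.

Lemma radon1 (P : 'M[R]_n) : Gr n m P ->
  radon m P (cst 1) = (m%:R * vol (@ball2 R m))%:E.
Proof.
move=> /onbP[UU _]; rewrite /radon /sub_int EFinM; congr (_ * _)%E.
rewrite -leb_int_punctured_ball//; apply: eq_leb_int => y.
by rewrite enorm_orthonormal.
Qed.

End Slices.

Theorem theorem1 (R : realType) (n k : nat) (K : set 'rV[R]_n)
    (f : 'rV[R]_n -> R) (eps : R) :
  (2 <= n)%N -> (1 <= k <= n - 1)%N ->
  gen_intersection_body k K ->
  {within K, continuous f} ->
  (forall x, K x -> f (- x) = f x) ->
  (forall x, K x -> 0 <= f x) ->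
  0 < eps ->
  (forall P, Gr n (n - k)%N P ->
     (sub_int (n - k)%N P (fun x => (\1_K x * f x)%:E) <= eps%:E)%E) ->
  (leb_int (fun x => (\1_K x * f x)%:E) <=
     (n%:R / (n - k)%:R * cnk n k * powR (vol K) (k%:R / n%:R) * eps)%:E)%E.
Proof.
move=> n2 /andP[k1 kn1] [starK [_ [nu [nufin nuGr nuE]]]] cf _ f0 eps0 slices.
have kn : (0 < k < n)%N.
  by rewrite k1 (leq_ltn_trans kn1)// subn1 prednK// ltnW.
have n0 : (0 < n)%N by exact: ltnW.
have m0 : (0 < n - k)%N by rewrite subn_gt0; case/andP: kn.
set m := (n - k)%N in m0 slices nuGr nuE *.
have mGr : measurable (Gr n m : set (@BorelM R n)) by exact: (@measurable_Gr R n m).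
have nuT : nu setT = nu (Gr n m : set (@BorelM R n)).
  rewrite -(setUv (Gr n m : set (@BorelM R n))) (measureU nu mGr (measurableC mGr)) ?setICr//.
  by rewrite [X in (_ + X)%E](nuGr : _ = 0%E) adde0.
(* Finiteness of nu turns the two estimates of its total mass into real inequalities, where division
   is available. *)
have nuf : nu (Gr n m) \is a fin_num.
  by rewrite ge0_fin_numE// -nuT.
have Bm0 := vol_ball2_gt0 R m.
have mr0 : 0 < m%:R :> R by rewrite ltr0n.
have nr0 : 0 < n%:R :> R by rewrite ltr0n.
have upper : (leb_int (fun x => (\1_K x * f x)%:E) <= eps%:E * nu (Gr n m))%E.
  apply: (le_trans (leb_int_le_sphere kn starK cf f0)).
  rewrite nuE; last exact: continuous_radial.
  apply: le_nnintegral_cst => // P GrP.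
  rewrite radon_radial// slices// andbT.
  apply: leb_int_ge0 => x; rewrite lee_fin indicE.
  by case: (boolP (_ \in K)); rewrite ?mul0r// inE mul1r; exact: f0.
have := nuE (cst 1) (continuous_subspaceT (fun x => cvg_cst _)).
have -> : (\int[nu]_(P in Gr n m) radon m P (cst 1%R) =
    (m%:R * vol (@ball2 R m))%:E * nu (Gr n m))%E.
  rewrite -integral_cst//; apply: eq_integral => P; rewrite inE => GrP.
  by rewrite radon1.
move=> E.
have : ((m%:R * vol (@ball2 R m))%:E * nu (Gr n m) <=
   (n%:R * (powR (vol K) (k%:R / n%:R) * powR (vol (@ball2 R n)) (m%:R / n%:R)))%:E)%E.
  rewrite -E /sphere_int EFinM; apply: lee_wpmul2l; first by rewrite lee_fin.
  apply: le_trans (leb_int_mink_holder n0 starK kn).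
  by under eq_leb_int do rewrite mulr1.
rewrite -(fineK nuf) -EFinM lee_fin => nule.
apply: (le_trans upper); rewrite -(fineK nuf) -EFinM lee_fin mulrC ler_pM2r//.
(* Dividing by the area m |B_2^m| gives nu(Gr) <= n |K|^(k/n) |B_2^n|^(m/n) / (m |B_2^m|), which is
   (n/m) times [cnk n k] times |K|^(k/n). *)
rewrite /cnk -/m; move: nule; rewrite mulrC -ler_pdivlMr ?mulr_gt0// => /le_trans; apply.
rewrite le_eqVlt; apply/orP; left; apply/eqP.
by field; rewrite !gt_eqF.
Qed.
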